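(* Let $\mathcal{F}^\omega$ and $\mathcal{G}^\nu$ be weighted combinatorial species with $\mathcal{G}[\emptyset]=\emptyset$, with $[z^k]\mathcal{F}^\omega(z)>0$ for at least one $k\ge 1$, and such that $(\mathcal{F}^\omega\circ\mathcal{G}^\nu)(z)$ is not a polynomial. Suppose that for some integer $d\ge1$ the power series $\mathcal{G}^\nu(z)$ belongs to the class $\mathscr{S}_d$ with radius of convergence $\rho$, and that $\mathcal{F}^\omega(z)$ has radius of convergence strictly larger than $\mathcal{G}^\nu(\rho)$. Let $\mathsf{R}_n$ be the remainder obtained by deleting a uniformly chosen largest component from the random composite structure $\mathsf{S}_n$ drawn from $(\mathcal{F}\circ\mathcal{G})[n]$ with probability proportional to its weight (see context). Let $\mathsf{R}$ be a random element of $\mathscr{U}(\mathcal{F}'\circ\mathcal{G})=\bigcup_{k\ge0}(\mathcal{F}'\circ\mathcal{G})[k]$ with the Boltzmann distribution $$\mathbb{P}(\mathsf{R}=R)=\mu(R)\,\frac{\rho^{|R|}}{|R|!}\,\Big((\mathcal{F}')^\omega(\mathcal{G}^\nu(\rho))\Big)^{-1},\qquad R\in\mathscr{U}(\mathcal{F}'\circ\mathcal{G}),$$ where $\mu$ denotes the weighting of $(\mathcal{F}')^\omega\circ\mathcal{G}^\nu$. Then $$d_{\mathrm{TV}}(\mathsf{R}_n,\mathsf{R})\to0\qquad\text{as } n\to\infty,\ n\equiv0\bmod d.$$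
   Context: Class $\mathscr{S}_d$ ($d\ge1$ an integer): a power series $g(z)=\sum_{n\ge0}g_nz^n$ with non-negative coefficients and radius of convergence $\rho>0$ belongs to $\mathscr{S}_d$ if $g_n=0$ whenever $d\nmid n$, and, as $n\to\infty$ with $n\equiv0\bmod d$, $g_n/g_{n+d}\to\rho^d$ and $\frac1{g_n}\sum_{i+j=n}g_ig_j\to2g(\rho)<\infty$. Weighted species: a weighted species $\mathcal{F}^\omega$ assigns to each finite set $U$ a finite set $\mathcal{F}[U]$ of structures with a weight function $\omega:\mathcal{F}[U]\to\mathbb{R}_{\ge0}$, and to each bijection $\sigma:U\to V$ a weight-preserving bijection $\mathcal{F}[\sigma]:\mathcal{F}[U]\to\mathcal{F}[V]$, functorially (identities go to identities, compositions to compositions); moreover $\mathcal{F}[U]\cap\mathcal{F}[V]=\emptyset$ for $U\neq V$. For $F\in\mathcal{F}[U]$ its size is $|F|=|U|$. Write $[n]=\{1,\dots,n\}$, $\mathcal{F}[n]=\mathcal{F}[[n]]$, $\mathscr{U}(\mathcal{F})=\bigcup_{n\ge0}\mathcal{F}[n]$. Exponential generating series: $\mathcal{F}^\omega(z)=\sum_{F\in\mathscr{U}(\mathcal{F})}\omega(F)z^{|F|}/|F|!$. Composition: if $\mathcal{G}[\emptyset]=\emptyset$, then $(\mathcal{F}\circ\mathcal{G})[U]=\bigcup_\pi\mathcal{F}[\pi]\times\prod_{Q\in\pi}\mathcal{G}[Q]$, with $\pi$ ranging over all partitions of $U$ into non-empty classes; the weight of $(F,(G_Q)_{Q\in\pi})$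 is $\omega(F)\prod_{Q\in\pi}\nu(G_Q)$. A bijection $\sigma:U\to V$ acts by transporting the partition, $F$ (along $Q\mapsto\sigma(Q)$), and each $G_Q$ (along $\sigma|_Q$). The generating series of $\mathcal{F}^\omega\circ\mathcal{G}^\nu$ is $\mathcal{F}^\omega(\mathcal{G}^\nu(z))$. Derived species: $\mathcal{F}'[U]=\mathcal{F}[U\cup\{*\}]$ with $*\notin U$ a placeholder not counted in the size; weights are inherited from $\mathcal{F}^\omega$, bijections are extended by fixing $*$. Its generating series is $(\mathcal{F}')^\omega(z)=\frac{d}{dz}\mathcal{F}^\omega(z)$. The weighting $\mu$ on $(\mathcal{F}')^\omega\circ\mathcal{G}^\nu$ is $\mu(F,(G_Q)_Q)=\omega(F)\prod_Q\nu(G_Q)$. Remainder $\mathsf{R}_n$: for each $n$ with $[z^n](\mathcal{F}^\omega\circ\mathcal{G}^\nu)(z)>0$, let $\mathsf{S}_n=(\mathsf{F}_n,(\mathsf{G}_Q)_{Q\in\pi_n})$ be drawn from $(\mathcal{F}\circ\mathcal{G})[n]$ with probability proportional to its weight. Choose $Q_0\in\pi_n$ uniformly at random among the classes of maximal size, relabel the atom $Q_0$ of $\mathsf{F}_n$ to $*$ to obtain $\mathsf{F}_n'\in\mathcal{F}'[\pi_n\setminus\{Q_0\}]$, and let $\mathsf{R}_n\in(\mathcal{F}'\circ\mathcal{G})[n-|Q_0|]$ be obtained from $(\mathsf{F}_n',(\mathsf{G}_Q)_{Q\in\pi_n\setminus\{Q_0\}})\in(\mathcal{F}'\circ\mathcal{G})[[n]\setminus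 Q_0]$ by relabelling along the unique order-preserving bijection $[n]\setminus Q_0\to[n-|Q_0|]$. Total variation distance for random variables in a countable set $S$: $d_{\mathrm{TV}}(X,Y)=\sup_{\mathcal{E}\subset S}|\mathbb{P}(X\in\mathcal{E})-\mathbb{P}(Y\in\mathcal{E})|$. *)

(* Defs.v *)
From HB Require Import structures.
From mathcomp Require Import all_boot all_order all_algebra.
From mathcomp Require Import boolp.

Set Implicit Arguments.
Unset Strict Implicit.
Unset Printing Implicit Defensive.

Import Order.TTheory GRing.Theory Num.Theory.
Local Open Scope ring_scope.

(* Finite label sets are finTypes.  Structures over different label sets live
   in different types, so the disjointness requirement of the usual
   set-theoretic definition is automatic.  Since sp_tr takes the bijectivity
   proof as an argument and the laws hold for all such proofs, each sp_tr s is
   itself a bijection, with inverse the transport along the inverse of s. *)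
Record species (R : numDomainType) := Species {
  sp_str :> finType -> finType;
  sp_wt : forall U : finType, sp_str U -> R;
  sp_tr : forall (U V : finType) (s : U -> V),
    bijective s -> sp_str U -> sp_str V;
  sp_wt_ge0 : forall (U : finType) (x : sp_str U), 0 <= sp_wt x;
  sp_tr_id : forall (U : finType) (h : bijective (@id U)) (x : sp_str U),
    sp_tr h x = x;
  sp_tr_comp : forall (U V W : finType) (s : U -> V) (t : V -> W)
      (hs : bijective s) (ht : bijective t) (hts : bijective (t \o s))
      (x : sp_str U),
    sp_tr hts x = sp_tr ht (sp_tr hs x);
  sp_wt_tr : forall (U V : finType) (s : U -> V) (hs : bijective s)
      (x : sp_str U),
    sp_wt (sp_tr hs x) = sp_wt x }.

Definition elts (U : finType) (A : {set U}) : finType := {x : U | x \in A}.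

Definition set_partition (U : finType) : finType :=
  {p : {set {set U}} | partition p [set: U]}.

Lemma sp_tr_ext (R : numDomainType) (F : species R) (U V : finType)
    (s t : U -> V) (hs : bijective s) (ht : bijective t) (x : F U) :
  s =1 t -> sp_tr hs x = sp_tr ht x.
Proof.
move=> /funext st; case: _ / st ht => ht.
by rewrite (Prop_irrelevance hs ht).
Qed.

Lemma elts_bij (U V : finType) (A : {set U}) (B : {set V}) (f : U -> V)
    (s : elts A -> elts B) :
  injective f -> B = f @: A -> (forall x, sval (s x) = f (sval x)) ->
  bijective s.
Proof.
move=> finj BE sE; apply: inj_card_bij.
  by move=> x y /(congr1 sval); rewrite !sE => /finj /val_inj.
by rewrite /elts !card_sig BE card_imset.
Qed.

(* Derived species: the placeholder * is None. *)
Section Derivative.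
Variables (R : numDomainType) (F : species R).

Lemma omap_bij (U V : finType) (s : U -> V) : bijective s -> bijective (omap s).
Proof. by case=> t st ts; exists (omap t); case=> //= x; rewrite ?st ?ts. Qed.

Definition deriv_tr (U V : finType) (s : U -> V) (hs : bijective s) :
  F (option U) -> F (option V) := sp_tr (omap_bij hs).

Lemma deriv_tr_id (U : finType) (h : bijective (@id U)) (x : F (option U)) :
  deriv_tr h x = x.
Proof.
have hid : bijective (@id (option U)) by exists id.
by rewrite -[RHS](sp_tr_id hid); apply: sp_tr_ext; case.
Qed.

Lemma deriv_tr_comp (U V W : finType) (s : U -> V) (t : V -> W)
    (hs : bijective s) (ht : bijective t) (hts : bijective (t \o s))
    (x : F (option U)) :
  deriv_tr hts x = deriv_tr ht (deriv_tr hs x).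
Proof.
rewrite /deriv_tr -(sp_tr_comp _ _ (bij_comp (omap_bij ht) (omap_bij hs))).
by apply: sp_tr_ext; case.
Qed.

Definition species_deriv : species R :=
  @Species R (fun U => F (option U)) (fun U => @sp_wt R F (option U)) deriv_tr
    (fun U => @sp_wt_ge0 R F (option U)) deriv_tr_id deriv_tr_comp
    (fun U V s hs => sp_wt_tr (omap_bij hs)).

End Derivative.

Section Composition.
Variables (R : numDomainType) (F G : species R).

Definition comp_str (U : finType) : finType :=
  {p : set_partition U &
    (F (elts (sval p)) *
     {dffun forall Q : elts (sval p), G (elts (sval Q))})%type}.

Definition comp_partition (U : finType) (c : comp_str U) : {set {set U}} :=
  sval (tag c).
Definition comp_outer (U : finType) (c : comp_str U) :
  F (elts (comp_partition c)) := (tagged c).1.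
Definition comp_inner (U : finType) (c : comp_str U)
  (Q : elts (comp_partition c)) : G (elts (sval Q)) := (tagged c).2 Q.

Definition comp_wt (U : finType) (c : comp_str U) : R :=
  sp_wt (comp_outer c) *
  \prod_(Q : elts (comp_partition c)) sp_wt (comp_inner Q).

Definition comp_mk (U : finType) (p : {set {set U}})
    (hp : partition p [set: U]) (f : F (elts p))
    (g : forall Q : elts p, G (elts (sval Q))) : comp_str U :=
  existT (fun p : set_partition U => (F (elts (sval p)) *
     {dffun forall Q : elts (sval p), G (elts (sval Q))})%type)
   (exist _ p hp : set_partition U) (f, [ffun Q : elts p => g Q]).

Section Transport.
Variables (U V : finType) (s : U -> V) (hs : bijective s).

Definition tr_partition (p : {set {set U}}) : {set {set V}} :=
  [set s @: (Q : {set U}) | Q in p].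

Lemma tr_preimset (Q : {set U}) : s @^-1: (s @: Q) = Q.
Proof.
by apply/setP=> x; rewrite inE mem_imset //; apply: bij_inj.
Qed.

Lemma tr_imset (Q : {set V}) : s @: (s @^-1: Q) = Q.
Proof.
case: hs => t st ts; apply/setP=> y; apply/imsetP/idP.
  by move=> [x]; rewrite inE => xQ ->.
by move=> yQ; exists (t y); rewrite ?inE ts.
Qed.

Lemma mem_tr_partition (p : {set {set U}}) (Q : {set V}) :
  (Q \in tr_partition p) = (s @^-1: Q \in p).
Proof.
apply/imsetP/idP => [[Q0 Q0p ->]|Qp]; first by rewrite tr_preimset.
by exists (s @^-1: Q); rewrite ?tr_imset.
Qed.

Lemma partition_tr (p : {set {set U}}) :
  partition p [set: U] -> partition (tr_partition p) [set: V].
Proof.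
case/and3P=> /eqP covp /trivIsetP trp p0; apply/and3P; split.
- apply/eqP/setP => y; rewrite inE; case: hs => t st ts.
  have : t y \in cover p by rewrite covp inE.
  case/bigcupP => Q Qp tyQ; apply/bigcupP; exists (s @: Q).
    by rewrite mem_tr_partition tr_preimset.
  by apply/imsetP; exists (t y); rewrite ?ts.
- apply/trivIsetP => A B; rewrite !mem_tr_partition => Ap Bp AB.
  have /trp : s @^-1: A != s @^-1: B.
    by apply: contra_neq AB => e; rewrite -(tr_imset A) e tr_imset.
  move=> /(_ Ap Bp) /pred0P d; apply/pred0P => y /=; case: hs => t st ts.
  by have := d (t y); rewrite /= !inE ts.
- by rewrite mem_tr_partition preimset0.
Qed.

Definition tr_block (p : {set {set U}}) (Q : elts p) : elts (tr_partition p) :=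
  exist _ (s @: sval Q) (imset_f _ (svalP Q)).

Lemma tr_block_bij (p : {set {set U}}) : bijective (@tr_block p).
Proof.
apply: (@elts_bij _ _ _ _ (fun Q : {set U} => s @: Q)) => //.
by apply: imset_inj; apply: bij_inj.
Qed.

Definition pre_block (p : {set {set U}}) (Q : elts (tr_partition p)) : elts p :=
  exist _ (s @^-1: sval Q) (etrans (esym (mem_tr_partition p (sval Q))) (svalP Q)).

Definition tr_restr (Q : {set V}) (x : elts (s @^-1: Q)) : elts Q :=
  exist _ (s (sval x))
    (etrans (esym (in_set (fun x => s x \in Q) (sval x))) (svalP x)).

Lemma tr_restr_bij (Q : {set V}) : bijective (@tr_restr Q).
Proof.
by apply: (@elts_bij _ _ _ _ s); rewrite ?tr_imset //; apply: bij_inj.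
Qed.

Definition comp_tr (c : comp_str U) : comp_str V :=
  comp_mk (partition_tr (svalP (tag c)))
    (sp_tr (@tr_block_bij (comp_partition c)) (comp_outer c))
    (fun Q => sp_tr (@tr_restr_bij (sval Q)) (comp_inner (pre_block Q))).

End Transport.

(* Equality of composite structures, without equality of dependent types. *)
Lemma comp_eq (U : finType) (c1 c2 : comp_str U) :
  comp_partition c1 = comp_partition c2 ->
  (forall (s : elts (comp_partition c1) -> elts (comp_partition c2))
     (hs : bijective s),
    (forall Q, sval (s Q) = sval Q) -> sp_tr hs (comp_outer c1) = comp_outer c2) ->
  (forall (Q1 : elts (comp_partition c1)) (Q2 : elts (comp_partition c2))
     (s : elts (sval Q1) -> elts (sval Q2)) (hs : bijective s),
    sval Q1 = sval Q2 -> (forall x, sval (s x) = sval x) ->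
    sp_tr hs (comp_inner Q1) = comp_inner Q2) ->
  c1 = c2.
Proof.
case: c1 c2 => [p1 [f1 g1]] [p2 [f2 g2]]; rewrite /comp_partition /=.
move=> /val_inj p12; case: _ / p12 f2 g2 => f2 g2 Hf Hg.
have hid (T : finType) : bijective (@id T) by exists id.
have -> : f1 = f2 by rewrite -[LHS](sp_tr_id (hid _)); apply: Hf.
congr existT; congr pair; apply/ffunP => Q.
by rewrite -[LHS](sp_tr_id (hid _)); apply: Hg.
Qed.

Lemma comp_inner_tr (U W : finType) (c : comp_str U)
    (Q1 Q2 : elts (comp_partition c)) (s : elts (sval Q1) -> W)
    (t : elts (sval Q2) -> W) (hs : bijective s) (ht : bijective t) :
  sval Q1 = sval Q2 -> (forall x y, sval x = sval y -> s x = t y) ->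
  sp_tr hs (comp_inner Q1) = sp_tr ht (comp_inner Q2).
Proof.
move=> /val_inj Q12; case: _ / Q12 t ht => t ht st.
by apply: sp_tr_ext => x; apply: st.
Qed.

Lemma comp_mk_inner (U : finType) (p : {set {set U}}) hp f g Q :
  comp_inner (c := @comp_mk U p hp f g) Q = g Q.
Proof. by rewrite /comp_inner /= ffunE. Qed.

Lemma comp_wt_ge0 (U : finType) (c : comp_str U) : 0 <= comp_wt c.
Proof.
by rewrite mulr_ge0 ?sp_wt_ge0 // prodr_ge0 // => Q _; apply: sp_wt_ge0.
Qed.

Lemma comp_tr_id (U : finType) (h : bijective (@id U)) (c : comp_str U) :
  comp_tr h c = c.
Proof.
apply: comp_eq => [|t ht tE|Q1 Q2 t ht Q12 tE].
- apply/setP=> Q; rewrite mem_tr_partition //.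
  by rewrite (_ : id @^-1: Q = Q) //; apply/setP => x; rewrite inE.
- have hid : bijective (@id (elts (comp_partition c))) by exists id.
  rewrite [comp_outer (comp_tr h c)]/= -(sp_tr_comp _ _ (bij_comp ht (tr_block_bij h _))).
  rewrite -[RHS](sp_tr_id hid); apply: sp_tr_ext => Q.
  by apply: val_inj; rewrite /= tE /= imset_id.
- have hid : bijective (@id (elts (sval Q2))) by exists id.
  rewrite comp_mk_inner -(sp_tr_comp _ _ (bij_comp ht (tr_restr_bij h _))).
  rewrite -[RHS](sp_tr_id hid).
  apply: (comp_inner_tr (Q1 := pre_block h Q1)) => [|x y xy].
    by rewrite -Q12; apply/setP => x; rewrite inE.
  by apply: val_inj; rewrite /= tE.
Qed.

Lemma comp_tr_comp (U V W : finType) (s : U -> V) (t : V -> W)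
    (hs : bijective s) (ht : bijective t) (hts : bijective (t \o s))
    (c : comp_str U) :
  comp_tr hts c = comp_tr ht (comp_tr hs c).
Proof.
apply: comp_eq => [|r hr rE|Q1 Q2 r hr Q12 rE].
- apply/setP=> Q; rewrite !mem_tr_partition //.
  rewrite (_ : (t \o s) @^-1: Q = s @^-1: (t @^-1: Q)) //.
  by apply/setP => x; rewrite !inE.
- change (sp_tr hr (sp_tr (tr_block_bij hts _) (comp_outer c)) =
    sp_tr (tr_block_bij ht _) (sp_tr (tr_block_bij hs _) (comp_outer c))).
  rewrite -(sp_tr_comp _ _ (bij_comp hr (tr_block_bij hts _))).
  rewrite -(sp_tr_comp _ _ (bij_comp (tr_block_bij ht _) (tr_block_bij hs _))).
  by apply: sp_tr_ext => Q; apply: val_inj; rewrite /= rE /= imset_comp.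
- rewrite !comp_mk_inner.
  rewrite -(sp_tr_comp _ _ (bij_comp hr (tr_restr_bij hts _))).
  rewrite -(sp_tr_comp _ _ (bij_comp (tr_restr_bij ht _) (tr_restr_bij hs _))).
  apply: (comp_inner_tr (Q1 := pre_block hts Q1)
    (Q2 := pre_block hs (pre_block ht Q2))) => [|x y xy].
    by rewrite /= -Q12; apply/setP => x; rewrite !inE.
  by apply: val_inj; rewrite /= rE /= xy.
Qed.

Lemma comp_wt_tr (U V : finType) (s : U -> V) (hs : bijective s)
  (c : comp_str U) : comp_wt (comp_tr hs c) = comp_wt c.
Proof.
rewrite /comp_wt sp_wt_tr; congr (_ * _).
have hpre : bijective (@pre_block _ _ s hs (comp_partition c)).
  exists (tr_block s (p := _)) => Q; apply: val_inj => /=.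
    exact: tr_imset.
  exact: tr_preimset.
rewrite [RHS](reindex (pre_block hs (p := _))) /=; last exact: onW_bij.
by apply: eq_bigr => Q _; rewrite comp_mk_inner sp_wt_tr.
Qed.

Definition species_comp : species R :=
  @Species R comp_str comp_wt comp_tr comp_wt_ge0 comp_tr_id comp_tr_comp
    comp_wt_tr.

End Composition.

Section Remainder.
Variables (R : numDomainType) (F G : species R).

Section Delete.
Variables (U : finType) (c : species_comp F G U) (Q0 : elts (comp_partition c)).
Let p := comp_partition c.
Let rest : finType := elts (~: sval Q0).

Definition del_partition : {set {set rest}} :=
  [set [set x : rest | sval x \in (Q : {set U})] | Q in p :\ sval Q0].

Lemma val_del_block (Q : {set U}) : Q \in p -> Q != sval Q0 ->
  sval @: [set x : rest | sval x \in Q] = Q.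
Proof.
case/and3P: (svalP (tag c)) => _ /trivIsetP trp _ Qp QQ0.
apply/setP=> x; apply/imsetP/idP => [[y]|xQ]; first by rewrite inE => yQ ->.
have xQ0 : x \in ~: sval Q0.
  rewrite inE; apply/negP => xQ0.
  by have /pred0P/(_ x) := trp _ _ Qp (svalP Q0) QQ0; rewrite /= xQ xQ0.
by exists (exist _ x xQ0); rewrite ?inE.
Qed.

Lemma mem_del_partition (Q : {set rest}) :
  (Q \in del_partition) = (sval @: Q \in p :\ sval Q0).
Proof.
apply/imsetP/idP => [[Q1 Q1p ->]|Qp].
  by case/setD1P: (Q1p) => Q10 Q1p'; rewrite val_del_block.
exists (sval @: Q) => //; apply/setP => x; rewrite inE.
by rewrite mem_imset //; apply: val_inj.
Qed.

Lemma partition_del : partition del_partition [set: rest].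
Proof.
case/and3P: (svalP (tag c)) => /eqP covp /trivIsetP trp p0; apply/and3P; split.
- apply/eqP/setP => y; rewrite inE.
  have : sval y \in cover p by rewrite /p /comp_partition covp inE.
  case/bigcupP => Q Qp yQ; apply/bigcupP; exists [set x : rest | sval x \in Q].
    apply: imset_f; rewrite !inE Qp andbT; apply/eqP => QQ0.
    by have := svalP y; rewrite inE => /negP; apply; move: yQ; rewrite {1}QQ0.
  by rewrite inE.
- apply/trivIsetP => A B; rewrite !mem_del_partition.
  move=> /setD1P[_ Ap] /setD1P[_ Bp] AB.
  have /trp : sval @: A != sval @: B.
    by apply: contra_neq AB; apply: imset_inj; apply: val_inj.
  move=> /(_ Ap Bp) /pred0P d; apply/pred0P => y /=.
  by have := d (sval y); rewrite /= !mem_imset //; apply: val_inj.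
- by rewrite mem_del_partition imset0 !inE (negPf p0) andbF.
Qed.

(* Relabelling of the outer structure: Q0 becomes *, every other class Q
   becomes Q seen as a subset of the complement of Q0 (insub is never None
   there). *)
Definition del_block (Q : elts p) : option (elts del_partition) :=
  if Q == Q0 then None else insub [set x : rest | sval x \in sval Q].

Lemma del_blockP (Q : elts p) (QQ0 : Q != Q0) :
  omap sval (del_block Q) = Some [set x : rest | sval x \in sval Q].
Proof.
rewrite /del_block (negPf QQ0) insubT /=; last by [].
by rewrite mem_del_partition val_del_block ?inE ?(svalP Q) ?andbT //.
Qed.

Lemma del_block_bij : bijective del_block.
Proof.
apply: inj_card_bij.
  move=> Q1 Q2 e.
  case: (eqVneq Q1 Q0) => [Q1E|n1]; case: (eqVneq Q2 Q0) => [Q2E|n2].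
  - by rewrite Q1E.
  - by have := del_blockP n2; rewrite -e Q1E /del_block eqxx.
  - by have := del_blockP n1; rewrite e Q2E /del_block eqxx.
  have := del_blockP n1; rewrite e del_blockP // => -[e'].
  apply: val_inj => /=; rewrite -(val_del_block (svalP Q1)) //.
  by rewrite -e' (val_del_block (svalP Q2)).
rewrite card_option /elts !card_sig.
rewrite card_in_imset.
  by rewrite (cardsD1 (sval Q0) p) (svalP Q0).
move=> A B /setD1P[A0 Ap] /setD1P[B0 Bp] e.
by rewrite -(val_del_block Ap A0) e val_del_block.
Qed.

Definition undel_block (Q : elts del_partition) : elts p :=
  exist _ (sval @: sval Q)
    (subsetP (subsetDl p [set sval Q0]) _
      (etrans (esym (mem_del_partition (sval Q))) (svalP Q))).

Lemma del_atom_rest (A : {set rest}) (x : elts (sval @: A)) :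
  sval x \in ~: sval Q0.
Proof. by case: x => x /= /imsetP[y _ ->]; exact: (svalP y). Qed.

Lemma del_atom_mem (A : {set rest}) (x : elts (sval @: A)) :
  (exist _ (sval x) (del_atom_rest x) : rest) \in A.
Proof.
case: x (del_atom_rest _) => x /= /imsetP[y yA ->] h.
by rewrite (_ : exist _ _ _ = y) //; apply: val_inj.
Qed.

Definition del_atom (A : {set rest}) (x : elts (sval @: A)) : elts A :=
  exist _ (exist _ (sval x) (del_atom_rest x)) (del_atom_mem x).

Lemma del_atom_bij (A : {set rest}) : bijective (@del_atom A).
Proof.
apply: inj_card_bij.
  by move=> x y /(congr1 (fun z => sval (sval z))) /= /val_inj.
by rewrite /elts !card_sig card_imset //; apply: val_inj.
Qed.

Definition delete_class : species_comp (species_deriv F) G rest :=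
  @comp_mk R (species_deriv F) G rest del_partition partition_del
    (sp_tr del_block_bij (comp_outer c))
    (fun Q => sp_tr (@del_atom_bij (sval Q)) (comp_inner (undel_block Q))).

End Delete.

Definition max_class (U : finType) (c : species_comp F G U)
    (Q : elts (comp_partition c)) : bool :=
  [forall Q' : elts (comp_partition c), #|sval Q'| <= #|sval Q|]%N.

(* The increasing bijection from the complement of A onto {0, ..., n-#|A|-1}. *)
Section ComplRank.
Variables (n : nat) (A : {set 'I_n}).

Lemma card_compl : #|~: A| = (n - #|A|)%N.
Proof. by rewrite cardsCs setCK card_ord. Qed.

Lemma compl_rank_subproof (x : elts (~: A)) :
  (#|[set y in ~: A | y < sval x]| < n - #|A|)%N.
Proof.
rewrite -card_compl; apply: proper_card; apply/properP; split.
  by apply/subsetP => y; rewrite inE => /andP[].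
by exists (sval x); [exact: (svalP x)|rewrite inE ltnn andbF].
Qed.

Definition compl_rank (x : elts (~: A)) : 'I_(n - #|A|) :=
  Ordinal (compl_rank_subproof x).

Lemma compl_rank_lt (x y : elts (~: A)) :
  (sval x < sval y)%N -> (compl_rank x < compl_rank y)%N.
Proof.
move=> xy; apply: proper_card; apply/properP; split.
  apply/subsetP => z; rewrite !inE => /andP[-> zx] /=; exact: ltn_trans xy.
by exists (sval x); rewrite inE ?ltnn ?andbF // xy andbT; exact: (svalP x).
Qed.

Lemma compl_rank_bij : bijective compl_rank.
Proof.
apply: inj_card_bij; last by rewrite card_ord /elts card_sig -card_compl.
move=> x y e; apply: val_inj; apply: val_inj => /=.
by case: (ltngtP (sval x) (sval y)) => // /compl_rank_lt; rewrite e ltnn.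
Qed.

End ComplRank.

(* All structures on the label sets [n], a structure of size n being tagged
   by n. *)
Definition structures (H : species R) : countType := {n : nat & H 'I_n}.

Definition remainder (n : nat) (c : species_comp F G 'I_n)
    (Q : elts (comp_partition c)) : structures (species_comp (species_deriv F) G) :=
  Tagged (fun k => species_comp (species_deriv F) G 'I_k)
    (sp_tr (compl_rank_bij (sval Q)) (delete_class Q)).

End Remainder.

From mathcomp Require Import classical_sets reals ereal topology normedtype.
From mathcomp Require Import sequences esum exp.
Import numFieldNormedType.Exports.
Local Open Scope classical_set_scope.

Section PowerSeries.
Variable R : realType.
Implicit Types (u g : nat -> R) (d : nat) (rho : R).

Definition psum u (x : R) : R := limn (pseries u x).

Definition conv_radius u : \bar R :=
  ereal_sup [set `|x|%:E | x in [set x : R | cvgn (pseries u x)]].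

Definition is_polynomial u : Prop :=
  exists p : {poly R}, forall n, u n = p`_n.

(* The class S_d; rho is the radius of convergence.  As x / 0 = 0 and
   rho ^+ d > 0, the first limit forces g n to be eventually nonzero along the
   multiples of d. *)
Definition in_class_S d rho g : Prop :=
  [/\ forall n, 0 <= g n, 0 < rho & conv_radius g = rho%:E] /\
  [/\ forall n, ~~ (d %| n)%N -> g n = 0,
      g n / g (n + d)%N @[n --> within [set n | (d %| n)%N] \oo] --> rho ^+ d,
      cvgn (pseries g rho) &
      (g n)^-1 * (\sum_(i < n.+1) g i * g (n - i)%N)
        @[n --> within [set n | (d %| n)%N] \oo] --> 2 * psum g rho].

Definition egf (H : species R) (n : nat) : R :=
  (\sum_(x : H 'I_n) sp_wt x) / n`!%:R.

End PowerSeries.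

(* Total variation distance between the laws with mass functions p and q. *)
Definition dTV (R : realType) (S : countType) (p q : S -> R) : \bar R :=
  ereal_sup [set `| \esum_(x in E) (p x)%:E - \esum_(x in E) (q x)%:E |%E
            | E in [set: set S]].

Section Laws.
Variables (R : realType) (F G : species R).

Definition composite_law (n : nat) (c : species_comp F G 'I_n) : R :=
  sp_wt c / \sum_(c' : species_comp F G 'I_n) sp_wt c'.

(* The law of R_n: draw S_n from composite_law, then a uniform class of maximal
   size.  When n = 0 or the coefficient of z^n vanishes, R_n is not defined
   and this function is identically 0. *)
Definition remainder_law (n : nat)
    (r : structures (species_comp (species_deriv F) G)) : R :=
  \sum_(c : species_comp F G 'I_n) composite_law c *
    \sum_(Q : elts (comp_partition c) | max_class Q)
      (#|[pred Q' : elts (comp_partition c) | max_class Q']|%:R)^-1 *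
      (remainder Q == r)%:R.

Definition boltzmann (rho : R)
    (r : structures (species_comp (species_deriv F) G)) : R :=
  sp_wt (tagged r) * (rho ^+ tag r / (tag r)`!%:R) *
  (psum (egf (species_deriv F)) (psum (egf G) rho))^-1.

End Laws.

Arguments composite_law {R} F G n c.
Arguments remainder_law {R} F G n r.
Arguments boltzmann {R} F G rho r.

(* Main.v *)
(* Deleting a class A from a composite structure is a bijection onto pairs of an
   (F' o G)-structure on the complement of A and a G-structure on A.  Counting
   pairs (structure, class) through it gives, with g, a, h the coefficients of
   G, F o G, F' o G:
   - n a_n = sum_j j g_j h_(n-j), whence a_n = sum_k f_k [z^n] G(z)^k;
   - P(R_n = r) = mu(r) / m! * g_(n-m) / a_n for a structure r of size m < n/2,
     since a class with more than n/2 atoms is the unique maximal one.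
   Put b_n = g_n rho^n and B = G(rho).  By induction on k, [z^n] b(z)^k / b_n
   tends to k B^(k-1), and Kesten's bound K beta^k, with B < beta inside the disc
   of convergence of F, dominates this ratio.  Hence a_n / g_n tends to F'(B), so
   the mass functions converge pointwise to the Boltzmann one, which has total
   mass 1, and Scheffe's argument yields convergence in total variation. *)
Require Import Defs.
From mathcomp Require Import all_boot all_order all_algebra.
From mathcomp Require Import boolp.
Set Implicit Arguments.
Unset Strict Implicit.
Unset Printing Implicit Defensive.
Import Order.TTheory GRing.Theory Num.Theory.
Local Open Scope ring_scope.

(** * Deletion and insertion of a class *)

(** The combinatorial obstacle is typing: label sets are sigma types, so structures on equal classes
    need not have the same type. Components are therefore compared only after transport along
    bijections that preserve underlying elements, and deletion is shown bijective through
    injectivity and surjectivity, without an explicit inverse. On the analytic side everything is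
    divided by [b n], which is known to be positive only for large multiples of [d]; ratios are
    therefore studied along these multiples, and the sequences involved vanish elsewhere. The mass
    of the Boltzmann law is controlled from two sides: at most 1 as a pointwise limit of
    sub-probabilities, and at least [1 - e] on a finite set, found by truncating the series of [F']
    and then each power of [b]. *)

Section SpeciesTransport.
Variables (R : numDomainType) (H : species R).

Lemma id_bij (T : Type) : bijective (@id T).
Proof. by exists id. Qed.

Lemma sp_tr_bij (U V : finType) (s : U -> V) (hs : bijective s) :
  bijective (@sp_tr R H U V s hs).
Proof.
have [t st ts] := hs; have ht : bijective t by exists s.
exists (sp_tr ht) => x.
  rewrite -(sp_tr_comp hs ht (bij_comp ht hs)) -[RHS](sp_tr_id (id_bij U)).
  by apply: sp_tr_ext => y; apply: st.
rewrite -(sp_tr_comp ht hs (bij_comp hs ht)) -[RHS](sp_tr_id (id_bij V)).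
by apply: sp_tr_ext => y; apply: ts.
Qed.

Lemma sum_sp_wt_bij (U V : finType) (s : U -> V) :
  bijective s -> \sum_(x : H U) sp_wt x = \sum_(x : H V) sp_wt x.
Proof.
move=> hs; rewrite [RHS](reindex (sp_tr hs)); last exact/onW_bij/sp_tr_bij.
by apply: eq_bigr => x _; rewrite sp_wt_tr.
Qed.

Lemma card_eq_bij (U V : finType) : #|U| = #|V| -> exists s : U -> V, bijective s.
Proof.
move=> e; exists (fun x => enum_val (cast_ord e (enum_rank x))).
exists (fun y => enum_val (cast_ord (esym e) (enum_rank y))) => x;
  by rewrite enum_valK ?cast_ordK ?cast_ordKV enum_rankK.
Qed.

Lemma sum_sp_wt_card (U V : finType) :
  #|U| = #|V| -> \sum_(x : H U) sp_wt x = \sum_(x : H V) sp_wt x.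
Proof. by case/card_eq_bij => s /sum_sp_wt_bij. Qed.

(** Meant for [remainder], whose values carry their size as a tag: tagged structures can be equal
    only if the sizes agree, and then bijectivity of the transport leaves exactly one [x]. *)
Lemma sum_sp_wt_tagged (U : finType) (k m : nat) (s : U -> 'I_k)
    (hs : bijective s) (r : H 'I_m) :
  \sum_(x : H U | Tagged (fun k => H 'I_k) (sp_tr hs x) == Tagged (fun k => H 'I_k) r) sp_wt x
  = (k == m)%:R * sp_wt r.
Proof.
case: (eqVneq k m) => [km|km]; last first.
  rewrite mul0r big1 // => x /eqP /(congr1 (@tag _ _)) /= e.
  by rewrite e eqxx in km.
case: _ / km r => r; rewrite mul1r.
rewrite (eq_bigl (fun x => sp_tr hs x == r)); last first.
  by move=> x; rewrite eq_Tagged.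
have [t st ts] := sp_tr_bij hs.
rewrite (big_pred1 (t r)); first by rewrite -(sp_wt_tr hs) ts.
by move=> x; apply/eqP/eqP => [<-|->]; rewrite ?st ?ts.
Qed.

End SpeciesTransport.

Section Composite.
Variables (R : numDomainType) (F G : species R) (U : finType).

(** Converse of [comp_eq]: it extracts usable equations from an equality of composite structures,
    whose components live in dependent types. *)
Lemma comp_eqE (c1 c2 : comp_str F G U) : c1 = c2 ->
  [/\ comp_partition c1 = comp_partition c2,
   (forall (s : elts (comp_partition c1) -> elts (comp_partition c2))
     (hs : bijective s),
    (forall Q, sval (s Q) = sval Q) -> sp_tr hs (comp_outer c1) = comp_outer c2) &
   (forall (Q1 : elts (comp_partition c1)) (Q2 : elts (comp_partition c2))
     (s : elts (sval Q1) -> elts (sval Q2)) (hs : bijective s),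
    sval Q1 = sval Q2 -> (forall x, sval (s x) = sval x) ->
    sp_tr hs (comp_inner Q1) = comp_inner Q2)].
Proof.
move=> <-; split=> // [s hs sE|Q1 Q2 s hs Q12 sE].
  rewrite -[RHS](sp_tr_id (id_bij (elts (comp_partition c1)))).
  by apply: sp_tr_ext => Q; apply: val_inj; exact: sE.
rewrite -[RHS](sp_tr_id (id_bij (elts (sval Q2)))).
apply: comp_inner_tr => // x y xy.
by apply: val_inj; exact: etrans (sE x) xy.
Qed.

End Composite.

(** Only the membership proof is cast, so the underlying element is preserved by computation. *)
Definition elts_cast (T : finType) (A B : {set T}) (AB : A = B) (x : elts A) :
  elts B := exist _ (sval x) (eq_ind A (fun B => sval x \in B) (svalP x) B AB).

Lemma elts_cast_bij (T : finType) (A B : {set T}) (AB : A = B) :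
  bijective (elts_cast AB).
Proof. by exists (elts_cast (esym AB)) => x; apply: val_inj. Qed.


Section Deletion.
Variables (R : numDomainType) (F G : species R) (U : finType) (A : {set U}).
Implicit Type c : species_comp F G U.
Let FG' := species_comp (species_deriv F) G.

(* Fixing the class [A] in advance gives the two components of [del_pair] types
   that do not depend on the structure. *)
Definition with_class : finType := {c : species_comp F G U | A \in comp_partition c}.

Definition class_of (c : with_class) : elts (comp_partition (sval c)) :=
  exist _ A (svalP c).
Definition del_pair (c : with_class) : FG' (elts (~: A)) * G (elts A) :=
  (delete_class (class_of c), comp_inner (class_of c)).

Lemma mem_del_block c (Q0 : elts (comp_partition c)) (Q : {set U}) :
  Q \in comp_partition c -> Q != sval Q0 ->
  [set x : elts (~: sval Q0) | sval x \in Q] \in del_partition Q0.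
Proof.
by move=> Qp QQ0; rewrite mem_del_partition val_del_block ?inE ?QQ0 ?Qp.
Qed.

Lemma del_block_mem c (Q0 : elts (comp_partition c)) S :
  S \in del_partition Q0 -> sval @: S \in comp_partition c.
Proof. by rewrite mem_del_partition inE => /andP[]. Qed.

(** Weights are invariant under transport, and [undel_block] maps the classes left after deletion
    bijectively onto the classes other than [Q0]; only the factor of [Q0] splits off. *)
Lemma comp_wt_delete c (Q0 : elts (comp_partition c)) :
  sp_wt c = sp_wt (delete_class Q0) * sp_wt (comp_inner Q0).
Proof.
have outerE : sp_wt (comp_outer (delete_class Q0)) = sp_wt (comp_outer c).
  exact: sp_wt_tr (del_block_bij Q0) (comp_outer c).
rewrite -[LHS]/(comp_wt c) /comp_wt (bigD1 Q0) //.
rewrite -[sp_wt (delete_class Q0)]/(comp_wt _) /comp_wt outerE.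
rewrite [in RHS]mulrAC -!mulrA; congr (_ * (_ * _)).
pose h (Q : elts (comp_partition (delete_class Q0))) := undel_block Q.
have undelK (Q : elts (comp_partition c)) : Q != Q0 -> exists Q', h Q' = Q.
  move=> QQ0; have Q'p := mem_del_block (svalP Q) QQ0.
  by exists (exist (fun X => X \in del_partition Q0) _ Q'p); apply: val_inj;
    exact: val_del_block (svalP Q) QQ0.
have hinj : injective h.
  move=> Q1 Q2 /(congr1 sval) e; apply: val_inj; move: e.
  by apply: imset_inj; apply: val_inj.
have hN Q : h Q != Q0.
  by have := svalP Q; rewrite mem_del_partition !inE => /andP[].
(* [h] misses [Q0], so its inverse is only partial and is found by search. *)
rewrite (reindex_omap h (fun Q => [pick Q' | h Q' == Q])).
  apply: eq_big => [Q|Q _].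
    rewrite hN; case: pickP => [Q' /eqP/hinj ->|/(_ Q)]; first by rewrite eqxx.
    by rewrite eqxx.
  by rewrite comp_mk_inner sp_wt_tr.
move=> Q /undelK[Q' <-]; case: pickP => [Q'' /eqP/= -> //|/(_ Q')].
by rewrite eqxx.
Qed.

(** Only the effect of the relabelling [m] on underlying elements is recorded; by [sp_tr_ext] this
    determines the transport. *)
Lemma comp_inner_delete c (Q0 Q : elts (comp_partition c)) (QQ0 : sval Q != sval Q0)
    (D : elts (comp_partition (delete_class Q0))) :
  sval D = [set x : elts (~: sval Q0) | sval x \in sval Q] ->
  exists (m : elts (sval Q) -> elts (sval D)) (hm : bijective m),
    (forall x, sval (sval (m x)) = sval x) /\
    comp_inner D = sp_tr hm (comp_inner Q).
Proof.
move=> DE; have E : sval Q = sval @: sval D.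
  by rewrite DE (val_del_block (svalP Q) QQ0).
have hm := bij_comp (del_atom_bij (Q0 := Q0) (sval D)) (elts_cast_bij E).
exists (@del_atom _ _ _ _ _ Q0 (sval D) \o elts_cast E), hm; split=> //.
rewrite comp_mk_inner.
apply: (comp_inner_tr (Q1 := undel_block D) (Q2 := Q)); first exact: esym E.
by move=> x y xy; apply: val_inj; apply: val_inj.
Qed.

(** The structure can be read off the pair: its classes are [A] and the images of those left over,
    its outer structure is the deleted one with the placeholder renamed to [A], and each inner
    structure is a transport of one in the pair. *)
Lemma del_pair_inj : injective del_pair.
Proof.
move=> c1 c2 e.
have [eD eF eG] := comp_eqE (congr1 fst e).
have eA : comp_inner (class_of c1) = comp_inner (class_of c2) :> G (elts A).
  exact (congr1 snd e).
have sub (c c' : with_class) : del_partition (class_of c) = del_partition (class_of c') ->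
    {subset comp_partition (sval c) <= comp_partition (sval c')}.
  move=> ee Q Qp; case: (eqVneq Q A) => [->|QA]; first exact: svalP c'.
  have h := mem_del_block (Q0 := class_of c) Qp QA.
  rewrite -(val_del_block (Q0 := class_of c) Qp QA).
  by apply: (del_block_mem (Q0 := class_of c')); rewrite -ee.
have p12 : comp_partition (sval c1) = comp_partition (sval c2).
  by apply/setP => Q; apply/idP/idP; apply: sub.
apply: val_inj; apply: comp_eq => // [s hs sE|Q1 Q2 s hs Q12 sE].
  have {eF} e1 : sp_tr (omap_bij (elts_cast_bij eD))
      (sp_tr (del_block_bij (class_of c1)) (comp_outer (sval c1))) =
      sp_tr (del_block_bij (class_of c2)) (comp_outer (sval c2)).
    exact: (eF _ (elts_cast_bij eD) (fun=> erefl)).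
  (* Transport being injective, it suffices to compare the outer structures after [A] has become the
     placeholder, where [e1] applies. *)
  apply: (bij_inj (sp_tr_bij F (del_block_bij (class_of c2)))).
  rewrite -{}e1.
  rewrite -(sp_tr_comp hs _ (bij_comp (del_block_bij (class_of c2)) hs)).
  rewrite -(sp_tr_comp (del_block_bij (class_of c1)) _
    (bij_comp (omap_bij (elts_cast_bij eD)) (del_block_bij (class_of c1)))).
  apply: sp_tr_ext => Q.
  have osval_inj (T : finType) (B : {set T}) (x y : option (elts B)) :
      omap sval x = omap sval y -> x = y.
    by case: x y => [x|] [y|] // [] /val_inj ->.
  have [QA|QA] := eqVneq (sval Q) A.
    have -> : Q = class_of c1 by apply: val_inj.
    have sA : s (class_of c1) = class_of c2 by apply: val_inj; exact: sE.
    by rewrite -[LHS]/(del_block _ (s _)) sA /del_block [RHS]/= !eqxx.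
  apply: osval_inj; rewrite -[X in omap _ X]/(del_block (class_of c2) (s Q)).
  rewrite del_blockP; last by apply: contra_neq QA => sQ; rewrite -(sE Q) sQ.
  rewrite -[RHS]/(omap _ (omap _ _)) -[RHS]omap_comp.
  rewrite -[RHS]/(omap sval (del_block (class_of c1) Q)) del_blockP ?sE //.
have [QA|QA] := eqVneq (sval Q1) A.
  have AQ := etrans (esym QA) Q12.
  transitivity (sp_tr (elts_cast_bij AQ) (comp_inner (class_of c1) : G (elts A))).
    apply: (comp_inner_tr (Q1 := Q1) (Q2 := class_of c1)); first exact: QA.
    by move=> x y xy; apply: val_inj; exact: etrans (sE x) xy.
  rewrite eA -[RHS](sp_tr_id (id_bij (elts (sval Q2)))).
  apply: (comp_inner_tr (Q1 := class_of c2) (Q2 := Q2)); first exact: AQ.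
  by move=> x y xy; apply: val_inj.
have Q2A : sval Q2 != A by rewrite -Q12.
pose D1 : elts (comp_partition (delete_class (class_of c1))) :=
  exist (fun X => X \in del_partition (class_of c1)) _
    (mem_del_block (Q0 := class_of c1) (svalP Q1) QA).
pose D2 : elts (comp_partition (delete_class (class_of c2))) :=
  exist (fun X => X \in del_partition (class_of c2)) _
    (mem_del_block (Q0 := class_of c2) (svalP Q2) Q2A).
have D12 : sval D1 = sval D2 by apply/setP => x; rewrite !inE Q12.
have [m1 [hm1 [m1E D1E]]] := comp_inner_delete (Q0 := class_of c1) QA (D := D1) erefl.
have [m2 [hm2 [m2E D2E]]] := comp_inner_delete (Q0 := class_of c2) Q2A (D := D2) erefl.
have := eG D1 D2 _ (elts_cast_bij D12) D12 (fun=> erefl).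
rewrite D1E D2E => e12; apply: (bij_inj (sp_tr_bij G hm2)); rewrite -{}e12.
rewrite -(sp_tr_comp hs hm2 (bij_comp hm2 hs)).
rewrite -(sp_tr_comp hm1 _ (bij_comp (elts_cast_bij D12) hm1)).
apply: sp_tr_ext => x; apply: val_inj; apply: val_inj.
by rewrite /= m2E sE m1E.
Qed.

End Deletion.

Section Insertion.
Variables (R : numDomainType) (F G : species R) (U : finType) (A : {set U}).
Let FG' := species_comp (species_deriv F) G.
Hypothesis A0 : A != set0.
Variables (r : FG' (elts (~: A))) (x : G (elts A)).
Let pr := comp_partition (r : comp_str (species_deriv F) G _).

Definition ins_partition : {set {set U}} :=
  A |: [set sval @: (Q : {set elts (~: A)}) | Q in pr].

Lemma compl_val_imset (Q : {set elts (~: A)}) :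
  [set y : elts (~: A) | sval y \in (sval @: Q : {set U})] = Q.
Proof. by apply/setP => y; rewrite inE mem_imset //; apply: val_inj. Qed.

Lemma disjoint_val_imset (Q : {set elts (~: A)}) : [disjoint A & sval @: Q].
Proof.
apply/pred0P => y; apply/negP => /andP[/= yA /imsetP[z _ yz]].
by have := svalP z; rewrite inE -yz yA.
Qed.

Lemma partition_ins : partition ins_partition [set: U].
Proof.
case/and3P: (svalP (tag r)) => /eqP covp /trivIsetP trp p0; apply/and3P; split.
- apply/eqP/setP => y; rewrite inE; apply/bigcupP.
  case: (boolP (y \in A)) => yA; first by exists A; rewrite ?setU11.
  have yA' : y \in ~: A by rewrite inE.
  pose z : elts (~: A) := exist _ y yA'.
  have : z \in cover (sval (tag r)) by rewrite covp inE.
  case/bigcupP => Q Qp zQ; exists (sval @: Q).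
    by rewrite !inE imset_f ?orbT.
  by apply/imsetP; exists z.
- apply/trivIsetP => B C /setU1P[->|/imsetP[Q Qp ->]] /setU1P[->|/imsetP[Q' Qp' ->]].
  + by rewrite eqxx.
  + by move=> _; apply: disjoint_val_imset.
  + by move=> _; rewrite disjoint_sym; apply: disjoint_val_imset.
  + move=> QQ'; have /pred0P d : [disjoint Q & Q'].
      by apply: trp => //; apply: contra_neq QQ' => ->.
    apply/pred0P => y; apply/negP => /andP[/= /imsetP[z zQ ->] /imsetP[z' zQ' /val_inj zz']].
    by have := d z; rewrite /= zQ zz' zQ'.
- rewrite !inE negb_or eq_sym A0; apply/imsetP => -[Q Qp] /esym/eqP.
  by rewrite imset_eq0 => /eqP Q0; move/negP: p0; apply; rewrite -Q0.
Qed.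

Lemma A_notin_ins (Q : {set elts (~: A)}) : A != sval @: Q.
Proof.
apply/eqP => AE; have := disjoint_val_imset Q.
by rewrite -AE -setI_eq0 setIid (negPf A0).
Qed.

(** The renaming opposite to [del_block]. *)
Definition ins_block (Q : option (elts pr)) : elts ins_partition :=
  match Q with
  | None => exist (fun X => X \in ins_partition) A (setU11 _ _)
  | Some Q => exist (fun X => X \in ins_partition) (sval @: sval Q)
                (setU1r _ (imset_f _ (svalP Q)))
  end.

Lemma ins_block_bij : bijective ins_block.
Proof.
have inj : injective ins_block.
  case=> [Q|] [Q'|] // /(congr1 sval) /= => [e|e|e].
  - by congr Some; apply: val_inj; apply: (imset_inj val_inj).
  - by case/eqP: (A_notin_ins (sval Q)); exact: esym e.
  - by case/eqP: (A_notin_ins (sval Q')); exact: e.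
apply: inj_card_bij => //.
rewrite card_option /elts !card_sig /ins_partition cardsU1.
rewrite card_imset; last exact: (imset_inj val_inj).
case: imsetP => [[Q _ AE]|_]; last by rewrite add1n.
by case/eqP: (A_notin_ins Q).
Qed.

(* The inner structures are chosen from this specification; defining them would
   require a dependent case analysis on [sval Q' = A]. *)
Lemma ins_inner_exists (Q' : elts ins_partition) :
  exists y : G (elts (sval Q')),
    (forall s (hs : bijective s), sval Q' = A ->
       (forall z : elts (sval Q'), sval (s z) = sval z) -> sp_tr hs y = x) /\
    (forall (Q : elts pr) (s : elts (sval Q') -> elts (sval Q)) (hs : bijective s),
      sval Q' = sval @: sval Q -> (forall z, sval (sval (s z)) = sval z) ->
      sp_tr hs y = comp_inner (c := r) Q).
Proof.
have [Q'A|Q'A] := eqVneq (sval Q') A.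
  exists (sp_tr (elts_cast_bij (esym Q'A)) x); split=> [s hs _ sE|Q s hs e].
    rewrite -(sp_tr_comp _ hs (bij_comp hs (elts_cast_bij (esym Q'A)))).
    rewrite -[RHS](sp_tr_id (id_bij (elts A))); apply: sp_tr_ext => z.
    by apply: val_inj; exact: sE.
  by case/eqP: (A_notin_ins (sval Q)); rewrite -e.
have [Q Qp Q'E] : exists2 Q : {set elts (~: A)}, Q \in pr & sval Q' = sval @: Q.
  case/setU1P: (svalP Q') => [e|/imsetP[Q Qp e]]; first by rewrite e eqxx in Q'A.
  by exists Q.
pose QQ : elts pr := exist (fun X => X \in pr) Q Qp.
have wP (z : elts (sval QQ)) : sval (sval z) \in sval Q'.
  by rewrite Q'E imset_f // (svalP z).
pose w (z : elts (sval QQ)) : elts (sval Q') :=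
  exist (fun y => y \in sval Q') (sval (sval z)) (wP z).
have hw : bijective w.
  apply: inj_card_bij.
    by move=> y z /(congr1 sval) /= e; do 2!apply: val_inj.
  by rewrite /elts !card_sig Q'E card_imset //; apply: val_inj.
exists (sp_tr hw (comp_inner (c := r) QQ)); split=> [s hs e|Q2 s hs e sE].
  by rewrite e eqxx in Q'A.
have QE : sval QQ = sval Q2 by apply: (imset_inj val_inj); rewrite -e -Q'E.
rewrite -(sp_tr_comp hw hs (bij_comp hs hw)).
rewrite -[RHS](sp_tr_id (id_bij (elts (sval Q2)))).
apply: (comp_inner_tr (Q1 := QQ) (Q2 := Q2)) => // y z yz.
by do 2!apply: val_inj; rewrite /= sE /= -[RHS]/(sval (sval z)) -yz.
Qed.

(** Gluing: the outer structure of [r] is moved along [ins_block], and the inner structures are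
    picked by finite choice. Deleting [A] again then composes relabellings that fix all underlying
    elements. *)
Lemma del_pair_surj : exists c : with_class F G A, del_pair c = (r, x).
Proof.
have [g gP] := fin_all_exists ins_inner_exists.
pose c0 : species_comp F G U :=
  comp_mk partition_ins
    (@sp_tr R F _ _ _ ins_block_bij (comp_outer (r : comp_str (species_deriv F) G _))) g.
have c0A : A \in comp_partition c0 by apply: setU11.
exists (exist _ c0 c0A); congr pair; last first.
  rewrite comp_mk_inner -[LHS](sp_tr_id (id_bij (elts A))).
  have h := proj1 (gP (class_of (exist (fun c => A \in comp_partition c) c0 c0A)))
    _ (id_bij (elts A)).
  exact (h erefl (fun=> erefl)).
pose Q0 := class_of (exist (fun c => A \in comp_partition c) c0 c0A : with_class F G A).
have delE : del_partition Q0 = pr.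
  apply/setP => Q; rewrite mem_del_partition; apply/setD1P/idP => [[_]|Qp].
    case/setU1P => [e|/imsetP[Q' Qp /(imset_inj val_inj) -> //]].
    by case/eqP: (A_notin_ins Q); apply: esym.
  split; first by rewrite eq_sym; apply: A_notin_ins.
  exact: setU1r (imset_f _ Qp).
apply: comp_eq => [|s hs sE|Q1 Q2 s hs Q12 sE]; first exact: delE.
- rewrite -[LHS]/(sp_tr (omap_bij hs) (sp_tr (del_block_bij Q0) (sp_tr ins_block_bij
    (comp_outer (r : comp_str (species_deriv F) G _))))).
  have hid := bij_comp (del_block_bij Q0) ins_block_bij.
  rewrite -(sp_tr_comp ins_block_bij (del_block_bij Q0) hid).
  rewrite -(sp_tr_comp hid (omap_bij hs) (bij_comp (omap_bij hs) hid)).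
  rewrite -[RHS](sp_tr_id (id_bij (option (elts pr)))).
  apply: (@sp_tr_ext R F (option (elts pr)) (option (elts pr))) => -[Q|]; last first.
    rewrite -[LHS]/(omap s (del_block Q0 (ins_block None))).
    by rewrite (_ : ins_block None = Q0) /del_block ?eqxx //; apply: val_inj.
  rewrite -[LHS]/(omap s (del_block Q0 (ins_block (Some Q)))).
  have N : ins_block (Some Q) != Q0.
    by apply/eqP => /(congr1 sval) /= e; case/eqP: (A_notin_ins (sval Q)); apply: esym.
  have := @del_blockP R F G U c0 Q0 _ N; case: (del_block Q0 _) => // Q' [Q'E].
  rewrite -[LHS]/(Some (s Q')); congr Some; apply: val_inj.
  by rewrite [LHS]sE Q'E [LHS]compl_val_imset.
- rewrite comp_mk_inner.
  rewrite -(sp_tr_comp (del_atom_bij (Q0 := Q0) (sval Q1)) hs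
    (bij_comp hs (del_atom_bij (Q0 := Q0) (sval Q1)))).
  have h := proj2 (gP (undel_block (Q0 := Q0) Q1)) Q2 _
    (bij_comp hs (del_atom_bij (Q0 := Q0) (sval Q1))).
  have Q1E : sval (undel_block (Q0 := Q0) Q1) = sval @: sval Q2 by rewrite -Q12.
  have {}h := h Q1E (fun z => congr1 (fun y => sval y) (sE (del_atom z))).
  exact (etrans (congr1 (fun y => sp_tr _ y) (comp_mk_inner _)) h).
Qed.

End Insertion.

(** * Generating series *)

Section PointedSums.
Variables (R : numDomainType) (F G : species R).
Let FG' := species_comp (species_deriv F) G.

(** [del_pair] is a bijection onto a product along which the weight factors, and [P] concerns the
    first factor only. *)
Lemma sum_with_class (U : finType) (A : {set U}) (P : pred (FG' (elts (~: A)))) :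
  A != set0 ->
  \sum_(c : with_class F G A | P (delete_class (class_of c))) sp_wt (sval c)
  = (\sum_(r | P r) sp_wt r) * \sum_(x : G (elts A)) sp_wt x.
Proof.
move=> A0.
have [psi psiK] : exists psi, cancel psi (@del_pair R F G U A).
  have [psi psiP] := fin_all_exists
    (fun y : FG' (elts (~: A)) * G (elts A) => del_pair_surj A0 y.1 y.2).
  by exists psi => -[y1 y2]; rewrite psiP.
have bij : bijective (@del_pair R F G U A).
  by exists psi => // c; apply: del_pair_inj; rewrite psiK.
rewrite big_distrlr pair_big_dep.
rewrite [RHS](reindex (@del_pair R F G U A)); last exact: onW_bij.
apply: eq_big => [c|c _]; first by rewrite andbT.
exact: (comp_wt_delete (class_of c)).
Qed.

(** Exchanges the two summations. The type of [Q] depends on [c], so the class is first fixed as a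
    plain set [A], the form in which [sum_with_class] applies. *)
Lemma sum_pointed (U : finType)
    (H : forall c : species_comp F G U, elts (comp_partition c) -> R) :
  \sum_(c : species_comp F G U) \sum_(Q : elts (comp_partition c)) H c Q
  = \sum_(A : {set U} | A != set0) \sum_(c : with_class F G A) H (sval c) (class_of c).
Proof.
rewrite [RHS]big_mkcond.
(* The empty set is never a class, so its term is an empty sum. *)
have -> : \sum_(A : {set U}) (if A != set0 then
     \sum_(c : with_class F G A) H (sval c) (class_of c) else 0)
  = \sum_(A : {set U}) \sum_(c : with_class F G A) H (sval c) (class_of c).
  apply: eq_bigr => A _; case: ifPn => // /negPn/eqP A0; rewrite big1 // => c _.
  by case/and3P: (svalP (tag (sval c))) => _ _; rewrite -A0 (svalP c).
rewrite !sig_big_dep.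
pose f (t : {A : {set U} & with_class F G A}) :
    {c : species_comp F G U & elts (comp_partition c)} :=
  Tagged (fun c => elts (comp_partition c)) (class_of (tagged t)).
rewrite (reindex f) //; apply: onW_bij.
pose g (t : {c : species_comp F G U & elts (comp_partition c)}) :
    {A : {set U} & with_class F G A} :=
  Tagged (fun A => with_class F G A)
   (exist (fun c => sval (tagged t) \in comp_partition c) (tag t) (svalP (tagged t))
     : with_class F G (sval (tagged t))).
exists g => -[a b].
  rewrite /f /g; congr existT; exact: val_inj.
rewrite /f /g; congr existT; exact: val_inj.
Qed.

Lemma sum_card_set (n : nat) (f : nat -> R) :
  \sum_(A : {set 'I_n}) f #|A| = \sum_(j < n.+1) 'C(n, j)%:R * f j.
Proof.
have cardn (A : {set 'I_n}) : (#|A| < n.+1)%N by rewrite ltnS -[n in (_ <= n)%N]card_ord max_card.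
rewrite (partition_big (fun A => Ordinal (cardn A)) predT) //.
apply: eq_bigr => j _; rewrite (eq_bigr (fun=> f j)); last first.
  by move=> A /eqP <-.
rewrite sumr_const mulr_natl; congr (_ *+ _).
have := card_draws 'I_n j; rewrite card_ord => <-; apply: eq_card => A.
by rewrite [in RHS]inE.
Qed.

(** With [f] the identity, pointing at a class weighted by its size amounts to pointing at an
    atom. *)
Lemma sum_comp_pointed (n : nat) (f : nat -> R) :
  \sum_(c : species_comp F G 'I_n) \sum_(Q : elts (comp_partition c))
    sp_wt c * f #|sval Q| =
  \sum_(j < n.+1 | (0 < j)%N) 'C(n, j)%:R * f j *
    (\sum_(r : FG' 'I_(n - j)) sp_wt r) * \sum_(x : G 'I_j) sp_wt x.
Proof.
rewrite (sum_pointed (fun c Q => sp_wt c * f #|sval Q|)).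
pose h j := if (0 < j)%N then f j * (\sum_(r : FG' 'I_(n - j)) sp_wt r) *
  (\sum_(x : G 'I_j) sp_wt x) else 0.
transitivity (\sum_(A : {set 'I_n}) h #|A|); last first.
  rewrite sum_card_set [RHS]big_mkcond; apply: eq_bigr => j _.
  by rewrite /h; case: ifP => _; rewrite ?mulr0 // !mulrA.
rewrite big_mkcond; apply: eq_bigr => A _; rewrite /h card_gt0.
case: ifP => // A0.
transitivity ((\sum_(c : with_class F G A) sp_wt (sval c)) * f #|A|).
  by rewrite mulr_suml.
have -> := @sum_with_class _ A xpredT A0; rewrite mulrC mulrA.
congr (_ * _ * _); apply: sum_sp_wt_card; last by rewrite card_sig card_ord.
by rewrite card_ord /elts card_sig -card_compl.
Qed.

(** Here every class may be deleted, not only a maximal one. The deleted class must have [n - tag r]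
    atoms, a positive number, and the binomial coefficient counts its positions; the remainder then
    fixes the rest up to the structure on that class. *)
Lemma sum_remainder (n : nat) (r : structures FG') : (tag r < n)%N ->
  \sum_(c : species_comp F G 'I_n) \sum_(Q : elts (comp_partition c))
    sp_wt c * (remainder Q == r)%:R =
  'C(n, tag r)%:R * sp_wt (tagged r) * \sum_(x : G 'I_(n - tag r)) sp_wt x.
Proof.
case: r => m r mn.
rewrite (sum_pointed (fun c Q => sp_wt c * (remainder Q == Tagged (fun k => FG' 'I_k) r)%:R)).
pose h j := if (0 < j)%N then ((n - j)%N == m)%:R * sp_wt r *
  (\sum_(x : G 'I_j) sp_wt x) else 0.
transitivity (\sum_(A : {set 'I_n}) h #|A|); last first.
  have nm : (n - m < n.+1)%N by rewrite ltnS leq_subr.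
  rewrite sum_card_set (bigD1 (Ordinal nm)) //= big1 ?addr0.
    by rewrite /h subn_gt0 mn subKn ?eqxx ?mul1r ?bin_sub ?mulrA // ltnW.
  move=> j jnm; rewrite /h; case: ifP => _; rewrite ?mulr0 //.
  case: eqP => [njm|]; rewrite ?mul0r ?mulr0 //.
  case/eqP: jnm; apply: val_inj; rewrite /= -njm subKn //.
  by rewrite -ltnS.
rewrite big_mkcond; apply: eq_bigr => A _; rewrite /h card_gt0.
case: ifP => // A0.
pose P (y : FG' (elts (~: A))) :=
  Tagged (fun k => FG' 'I_k) (sp_tr (compl_rank_bij A) y) == Tagged (fun k => FG' 'I_k) r.
transitivity (\sum_(c : with_class F G A | P (delete_class (class_of c))) sp_wt (sval c)).
  rewrite [RHS]big_mkcond; apply: eq_bigr => c _.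
  rewrite -[remainder _]/(Tagged (fun k => FG' 'I_k) (sp_tr (compl_rank_bij A) _)) -/(P _).
  by case: ifP => _; rewrite ?mulr1 ?mulr0.
rewrite (sum_with_class _ A0) /P sum_sp_wt_tagged; congr (_ * _).
by apply: sum_sp_wt_card; rewrite card_sig card_ord.
Qed.

Lemma sum_card_blocks (U : finType) (c : species_comp F G U) :
  (\sum_(Q : elts (comp_partition c)) #|sval Q| = #|U|)%N.
Proof.
rewrite -cardsT (card_partition (svalP (tag c))).
by rewrite (big_sub (comp_partition c) (fun A : {set U} => #|A|)).
Qed.

(** The only partition of an empty set has no class, so both outer label sets are empty and the
    family of inner structures is vacuous. *)
Lemma sum_comp_empty (U : finType) : #|U| = 0%N ->
  \sum_(c : species_comp F G U) sp_wt c = \sum_(f : F U) sp_wt f.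
Proof.
move=> U0.
have UE (A : {set U}) : A = set0.
  by apply/eqP; rewrite -cards_eq0 -leqn0 -U0 max_card.
have part0 : partition (set0 : {set {set U}}) [set: U].
  by rewrite (UE [set: U]) partition_set0.
have no_block (c : species_comp F G U) : comp_partition c = set0.
  apply/setP => Q; rewrite inE; apply/negP => Qp.
  by case/and3P: (svalP (tag c)) => _ _ /negP; apply; rewrite -(UE Q).
have no_elt (T : finType) (x : elts (set0 : {set T})) : False.
  by have := svalP x; rewrite inE.
have [s hs] : exists s : U -> elts (set0 : {set {set U}}), bijective s.
  by apply: card_eq_bij; rewrite U0 card_sig cards0.
have [t st ts] := hs; have ht : bijective t by exists s.
pose psi (f : F U) : species_comp F G U :=
  comp_mk part0 (sp_tr hs f) (fun Q => False_rect _ (no_elt _ Q)).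
pose hc (c : species_comp F G U) := bij_comp ht (elts_cast_bij (no_block c)).
have psi_bij : bijective psi.
  exists (fun c => sp_tr (hc c) (comp_outer c)) => [f|c].
    rewrite -[comp_outer _]/(sp_tr hs f) -(sp_tr_comp hs (hc (psi f)) (bij_comp (hc (psi f)) hs)).
    by rewrite -[RHS](sp_tr_id (id_bij U)); apply: sp_tr_ext => x; case: (no_elt _ (s x)).
  apply: comp_eq => [|r hr _|Q1]; first exact: esym (no_block c).
    rewrite -[comp_outer (psi _)]/(sp_tr hs _).
    rewrite -(sp_tr_comp hs hr (bij_comp hr hs)).
    rewrite -(sp_tr_comp (hc c) _ (bij_comp (bij_comp hr hs) (hc c))).
    rewrite -[RHS](sp_tr_id (id_bij (elts (comp_partition c)))).
    by apply: sp_tr_ext => Q; case: (no_elt _ (elts_cast (no_block c) Q)).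
  by case: (no_elt _ Q1).
rewrite (reindex psi); last exact: onW_bij.
apply: eq_bigr => f _; rewrite -[LHS]/(_ * _) big_pred0 ?mulr1 ?sp_wt_tr //.
by move=> Q; case: (no_elt _ Q).
Qed.

End PointedSums.

From mathcomp Require Import classical_sets functions cardinality fsbigop.
From mathcomp Require Import reals constructive_ereal ereal topology.
From mathcomp Require Import normedtype sequences esum exp.
From mathcomp Require Import ring lra zify.
Import numFieldNormedType.Exports.
Local Open Scope classical_set_scope.
Local Open Scope ring_scope.

(** * Convolutions and coefficients of powers *)

Section Convolution.
Variable R : comNzRingType.
Implicit Types (u v w : nat -> R) (k n d : nat).

Definition conv u v n : R := \sum_(i < n.+1) u i * v (n - i)%N.

(** The coefficients of the power [u(z)^k]. *)
Fixpoint cpow u k : nat -> R :=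
  if k is k'.+1 then conv (cpow u k') u else fun n => (n == 0)%:R.

(** Truncation to polynomials: the ring laws of convolution are inherited from polynomial
    multiplication. *)
Lemma conv_coef u v N n : (n < N)%N ->
  conv u v n = ((\poly_(i < N) u i) * (\poly_(i < N) v i))`_n.
Proof.
move=> nN; rewrite coefM; apply: eq_bigr => -[i /=]; rewrite ltnS => i_n _.
by rewrite !coef_poly (leq_ltn_trans i_n nN) (leq_ltn_trans (leq_subr _ _) nN).
Qed.

Lemma eq_conv u u' v v' n : (forall i, (i <= n)%N -> u i = u' i) ->
  (forall i, (i <= n)%N -> v i = v' i) -> conv u v n = conv u' v' n.
Proof.
move=> uu vv; apply: eq_bigr => -[i /=]; rewrite ltnS => i_n _.
by rewrite uu // vv // leq_subr.
Qed.

Lemma convC u v n : conv u v n = conv v u n.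
Proof. by rewrite !(@conv_coef _ _ n.+1) // mulrC. Qed.

Lemma convAC u v w n : conv (conv u v) w n = conv (conv u w) v n.
Proof.
have E v' w' : conv (conv u v') w' n = ((\poly_(i < n.+1) u i) *
    (\poly_(i < n.+1) v' i) * (\poly_(i < n.+1) w' i))`_n.
  rewrite coefM; apply: eq_bigr => -[i /=]; rewrite ltnS => i_n _.
  by rewrite (@conv_coef _ _ n.+1) ?ltnS // [in RHS]coef_poly ltnS leq_subr.
by rewrite !E mulrAC.
Qed.

(** The Leibniz rule for the operator [z d/dz]. *)
Lemma conv_pointing u v n : n%:R * conv u v n =
  conv (fun i => i%:R * u i) v n + conv u (fun i => i%:R * v i) n.
Proof.
rewrite /conv mulr_sumr -big_split; apply: eq_bigr => -[i /=]; rewrite ltnS => i_n _.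
by rewrite -{1}(subnKC i_n) natrD mulrDl mulrA; congr (_ + _); rewrite mulrCA.
Qed.

(** The chain rule for [z d/dz] applied to [u(z)^(k+1)]. *)
Lemma cpow_pointing u k n :
  n%:R * cpow u k.+1 n = k.+1%:R * conv (cpow u k) (fun i => i%:R * u i) n.
Proof.
elim: k n => [|k IH] n.
  rewrite -[cpow u 1 n]/(conv (cpow u 0) u n) conv_pointing mul1r.
  by rewrite {1}/conv big1 ?add0r // => -[[|i] ?] _; rewrite /= ?mul0r ?mulr0 ?mul0r.
rewrite -[cpow u k.+2 n]/(conv (cpow u k.+1) u n) conv_pointing.
rewrite (@eq_conv _ (fun i => k.+1%:R * conv (cpow u k) (fun i => i%:R * u i) i) _ u) //.
rewrite {1}/conv; under eq_bigr do rewrite -mulrA.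
by rewrite -mulr_sumr -/(conv _ u n) convAC -[k.+2%:R]natr1 mulrDl mul1r.
Qed.

Lemma cpow_eq0 u k n : u 0 = 0 -> (n < k)%N -> cpow u k n = 0.
Proof.
move=> u0; elim: k n => // k IH n; rewrite ltnS => nk.
rewrite /= /conv big1 // => -[i /=]; rewrite ltnS leq_eqVlt => /predU1P[->|i_n] _.
  by rewrite subnn u0 mulr0.
by rewrite IH ?mul0r // (leq_trans i_n).
Qed.

Lemma cpow_dvdn u d k n : (forall i, ~~ (d %| i)%N -> u i = 0) ->
  ~~ (d %| n)%N -> cpow u k n = 0.
Proof.
move=> ud; elim: k n => [|k IH] n dn; first by case: n dn => //; rewrite dvdn0.
rewrite /= /conv big1 // => -[i /=]; rewrite ltnS => i_n _.
have [di|/IH->] := boolP (d %| i)%N; last by rewrite mul0r.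
by rewrite ud ?mulr0 // dvdn_subl.
Qed.

Lemma cpow_scale u x k n : cpow (fun i => u i * x ^+ i) k n = cpow u k n * x ^+ n.
Proof.
elim: k n => [|k IH] n; first by case: n => [|n]; rewrite /= ?mulr1 ?mul0r.
rewrite /= /conv mulr_suml; apply: eq_bigr => -[i /=]; rewrite ltnS => i_n _.
by rewrite IH mulrACA -exprD subnKC.
Qed.

End Convolution.

Section ConvolutionOrder.
Variable R : numDomainType.
Implicit Types u v : nat -> R.

Lemma conv_ge0 u v n : (forall i, 0 <= u i) -> (forall i, 0 <= v i) -> 0 <= conv u v n.
Proof. by move=> u0 v0; apply: sumr_ge0 => i _; apply: mulr_ge0. Qed.

Lemma cpow_ge0 u k n : (forall i, 0 <= u i) -> 0 <= cpow u k n.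
Proof. by move=> u0; elim: k n => [|k IH] n /=; [rewrite ler0n|exact: conv_ge0]. Qed.

End ConvolutionOrder.

Section ExponentialSeries.
Variables (R : realType) (F G : species R).

Lemma egf_ge0 (H : species R) n : 0 <= egf H n.
Proof. by rewrite divr_ge0 ?ler0n // sumr_ge0 // => x _; apply: sp_wt_ge0. Qed.

Lemma egf_deriv n : egf (species_deriv F) n = n.+1%:R * egf F n.+1.
Proof.
rewrite /egf factS natrM invfM [RHS]mulrCA mulVKf ?pnatr_eq0 //.
by congr (_ / _); apply: (sum_sp_wt_card F); rewrite card_option !card_ord.
Qed.

End ExponentialSeries.
(** The sizes of the classes add up to [n], so weighting each pointed class by its size multiplies
    the total weight by [n]. *)
Lemma egf_comp_pointing (R : realType) (F G : species R) n :
  n%:R * egf (species_comp F G) n =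
  conv (egf (species_comp (species_deriv F) G)) (fun j => j%:R * egf G j) n.
Proof.
have := sum_comp_pointed F G n (fun j => j%:R : R).
under eq_bigr => c _ do rewrite -mulr_sumr -natr_sum sum_card_blocks card_ord.
rewrite -mulr_suml => E; rewrite convC /conv /egf mulrA [n%:R * _]mulrC {}E.
rewrite big_mkcond mulr_suml; apply: eq_bigr => -[j /=]; rewrite ltnS => j_n _.
case: ifPn => [_|]; last by rewrite -leqNgt leqn0 => /eqP ->; rewrite !mul0r.
have nz (i : nat) : i`!%:R != 0 :> R by rewrite pnatr_eq0 -lt0n fact_gt0.
have Cnz : 'C(n, j)%:R != 0 :> R by rewrite pnatr_eq0 -lt0n bin_gt0.
set s := \sum_r _; set t := \sum_x _.
by rewrite -(bin_fact j_n) !natrM; field; rewrite !nz Cnz.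
Qed.

(* Induction on the size, for all [F] at once: pointing at an atom turns [F] into
   its derivative and leaves a smaller complement. *)
Lemma egf_comp (R : realType) (F G : species R) N n : egf G 0 = 0 -> (n <= N)%N ->
  egf (species_comp F G) n = \sum_(k < N.+1) egf F k * cpow (egf G) k n.
Proof.
move=> g0; elim: N F n => [|N IH] F n.
  rewrite leqn0 => /eqP ->; rewrite big_ord1 mulr1 /egf.
  by rewrite (@sum_comp_empty _ F G) // card_ord.
move=> nN; case: n nN => [|n] nN.
  rewrite big_ord_recl big1 ?addr0 => [|i _]; last by rewrite cpow_eq0 ?mulr0.
  by rewrite mulr1 /egf (@sum_comp_empty _ F G) // card_ord.
apply: (@mulfI _ n.+1%:R); first by rewrite pnatr_eq0.
rewrite egf_comp_pointing convC /conv big_ord_recl mul0r mul0r add0r.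
transitivity (\sum_(i < n.+1) \sum_(k < N.+1)
    (i.+1%:R * egf G i.+1) * (egf (species_deriv F) k * cpow (egf G) k (n - i)%N)).
  apply: eq_bigr => i _; rewrite -mulr_sumr; congr (_ * _).
  by rewrite (IH _ (n - i)%N) // (leq_trans (leq_subr _ _)).
rewrite exchange_big [in RHS]big_ord_recl mulr0 add0r mulr_sumr.
apply: eq_bigr => k _; rewrite egf_deriv [RHS]mulrCA cpow_pointing.
rewrite [in RHS]convC /conv [in RHS]big_ord_recl !mul0r add0r !mulr_sumr.
by apply: eq_bigr => i _; rewrite !lift0 subSS; ring.
Qed.

(** * The law of the remainder *)

Section RemainderLaw.
Variables (R : realType) (F G : species R).
Let FG' := species_comp (species_deriv F) G.

Lemma composite_law_ge0 n (c : species_comp F G 'I_n) : 0 <= composite_law F G n c.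
Proof. by rewrite divr_ge0 ?sp_wt_ge0 // sumr_ge0 // => c' _; apply: sp_wt_ge0. Qed.

(** An inequality, because the law is identically 0 when the total weight vanishes. *)
Lemma sum_composite_law_le1 n : \sum_(c : species_comp F G 'I_n) composite_law F G n c <= 1.
Proof.
rewrite -mulr_suml; have [->|S0] := eqVneq (\sum_(c : species_comp F G 'I_n) sp_wt c) 0.
  by rewrite mul0r.
by rewrite divff.
Qed.

Lemma remainder_law_ge0 n r : 0 <= remainder_law F G n r.
Proof.
apply: sumr_ge0 => c _; rewrite mulr_ge0 ?composite_law_ge0 //.
by apply: sumr_ge0 => Q _; rewrite mulr_ge0 ?invr_ge0 ?ler0n.
Qed.

Lemma sum_remainder_law_le1 n (s : seq (structures FG')) : uniq s ->
  \sum_(r <- s) remainder_law F G n r <= 1.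
Proof.
move=> us; rewrite exchange_big; apply: le_trans (sum_composite_law_le1 n).
apply: ler_sum => c _; rewrite -mulr_sumr -[leRHS]mulr1.
apply: ler_wpM2l; first exact: composite_law_ge0.
rewrite exchange_big.
apply: (@le_trans _ _ (\sum_(Q : elts (comp_partition c) | max_class Q)
    (#|[pred Q' : elts (comp_partition c) | max_class Q']|%:R)^-1)).
  apply: ler_sum => Q _; rewrite -mulr_sumr ler_piMr ?invr_ge0 ?ler0n //.
  rewrite -natr_sum -[leRHS]/(1%:R) ler_nat.
  (* A given remainder occurs at most once in the duplicate-free [s]. *)
  rewrite (_ : (\sum_(r <- s) _)%N = count_mem (remainder Q) s).
    by rewrite count_uniq_mem // leq_b1.
  by rewrite -sum1_count [RHS]big_mkcond; apply: eq_bigr => r _; rewrite /= eq_sym; case: eqP.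
rewrite (eq_bigl (mem [pred Q' : elts (comp_partition c) | max_class Q'])) //.
rewrite sumr_const -[leLHS]mulr_natr.
have [->|N0] := eqVneq #|[pred Q' : elts (comp_partition c) | max_class Q']| 0.
  by rewrite mulr0.
by rewrite mulVf // pnatr_eq0.
Qed.

Lemma max_class_half n (c : species_comp F G 'I_n) (Q Q' : elts (comp_partition c)) :
  (n < 2 * #|sval Q|)%N -> max_class Q' = (Q' == Q).
Proof.
move=> nQ.
have lt (Q2 : elts (comp_partition c)) : Q2 != Q -> (#|sval Q2| < #|sval Q|)%N.
  move=> Q2Q; have := sum_card_blocks c.
  rewrite (bigD1 Q) // (bigD1 Q2) // card_ord; set m := bigop.body _ _ _.
  rewrite /= addnA => e; rewrite -(ltn_add2l #|sval Q|) addnn -mul2n.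
  by apply: leq_ltn_trans nQ; apply: leq_trans (eq_leq e); apply: leq_addr.
have [->|Q'Q] := eqVneq Q' Q.
  by apply/forallP => Q2; have [->//|/lt/ltnW] := eqVneq Q2 Q.
apply/negbTE/forallPn; exists Q; rewrite -ltnNge; exact: lt.
Qed.

(** A class whose deletion leaves [r] has more than [n/2] atoms, so it is maximal without ties; the
    restriction and the normalising factor disappear and [sum_remainder] applies. *)
Lemma sum_max_class_remainder n (c : species_comp F G 'I_n) (r : structures FG') :
  (2 * tag r < n)%N ->
  \sum_(Q : elts (comp_partition c) | max_class Q)
      (#|[pred Q' : elts (comp_partition c) | max_class Q']|%:R)^-1 *
      (remainder Q == r)%:R =
  \sum_(Q : elts (comp_partition c)) (remainder Q == r)%:R :> R.
Proof.
move=> rn; rewrite big_mkcond; apply: eq_bigr => Q _.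
case: eqP => [E|_]; last by rewrite mulr0; case: ifP.
have cQ : (#|sval Q| <= n)%N by rewrite -[n in (_ <= n)%N]card_ord max_card.
have nQ : (n < 2 * #|sval Q|)%N.
  move: rn; rewrite -E -[tag _]/(n - #|sval Q|)%N.
  by move: cQ; clear; lia.
rewrite (max_class_half _ nQ) eqxx (@fintype.eq_card1 _ Q) ?invr1 ?mulr1 // => Q'.
by rewrite inE (max_class_half _ nQ) inE.
Qed.

Lemma remainder_lawE n r : (2 * tag r < n)%N ->
  remainder_law F G n r =
  sp_wt (tagged r) / (tag r)`!%:R * (egf G (n - tag r)%N / egf (species_comp F G) n).
Proof.
move=> rn; have rn' : (tag r < n)%N by lia.
rewrite /remainder_law.
under eq_bigr => c _ do rewrite (sum_max_class_remainder _ rn) /composite_law mulrAC mulr_sumr.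
rewrite -mulr_suml (sum_remainder rn') /egf.
set t := \sum_(x : G 'I_(n - tag r)) _.
set S := \sum_(c : species_comp F G 'I_n) _; rewrite -(bin_fact (ltnW rn')) !natrM.
have nz (i : nat) : i`!%:R != 0 :> R by rewrite pnatr_eq0 -lt0n fact_gt0.
(* If the total weight is 0, both sides vanish because the inverse of 0 is 0. *)
have [->|S0] := eqVneq S 0; first by rewrite mul0r !invr0 !mulr0.
by field; rewrite S0 !nz pnatr_eq0 -lt0n bin_gt0 ltnW.
Qed.

End RemainderLaw.

(** * Subexponential sequences *)

Lemma cvg_sum_ord (R : realType) (T : Type) (F : set_system T) (FF : Filter F)
    (f : nat -> T -> R) (l : nat -> R) N : (forall i, f i x @[x --> F] --> l i) ->
  \sum_(i < N) f i x @[x --> F] --> \sum_(i < N) l i.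
Proof.
move=> fl; elim: N => [|N IH].
  by under eq_fun do rewrite big_ord0; rewrite big_ord0; apply: cvg_cst.
by under eq_fun do rewrite big_ord_recr; rewrite big_ord_recr; apply: cvgD.
Qed.

Section Multiples.
Variable d : nat.
Hypothesis d_gt0 : (0 < d)%N.

Lemma near_multiplesP (P : nat -> Prop) :
  (\forall n \near within [set n | (d %| n)%N] \oo, P n) <->
  exists N, forall n, (N <= n)%N -> (d %| n)%N -> P n.
Proof.
rewrite near_withinE; split=> [[N _ NP]|[N NP]].
  by exists N => n /NP.
by exists N.
Qed.

Lemma multiples_proper : ProperFilter (within [set n | (d %| n)%N] \oo).
Proof.
apply: Build_ProperFilter_ex => P /near_multiplesP[N NP].
by exists (d * N)%N; apply: NP; rewrite ?leq_pmull ?dvdn_mulr.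
Qed.

Lemma cvg_subn_multiples m : (d %| m)%N ->
  (n - m)%N @[n --> within [set n | (d %| n)%N] \oo] --> within [set n | (d %| n)%N] \oo.
Proof.
move=> dm P /near_multiplesP[N NP]; apply/near_multiplesP; exists (N + m)%N => n Nn dn.
have mn : (m <= n)%N := leq_trans (leq_addl _ _) Nn.
by apply: NP; rewrite ?leq_subRL // ?[(m + N)%N]addnC // dvdn_subl.
Qed.

End Multiples.

Section Subexponential.
Variables (R : realType) (d : nat) (b : nat -> R) (B : R).
Hypothesis d_gt0 : (0 < d)%N.
Local Notation W := (within [set n | (d %| n)%N] \oo).
Hypothesis b_ge0 : forall n, 0 <= b n.
Hypothesis b_dvd : forall n, ~~ (d %| n)%N -> b n = 0.
Hypothesis b_ratio : b n / b (n + d)%N @[n --> W] --> (1 : R).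
Hypothesis b_sum : \sum_(i < n) b i @[n --> \oo] --> B.
Hypothesis b_conv : conv b b n / b n @[n --> W] --> 2 * B.

Let W_proper : ProperFilter W := multiples_proper d_gt0.
#[local] Existing Instance W_proper.

Lemma ratio_sub1 : b (n - d)%N / b n @[n --> W] --> (1 : R).
Proof.
have := cvg_comp _ _ (cvg_subn_multiples (dvdnn d)) b_ratio.
apply: cvg_trans; apply: near_eq_cvg; apply/near_multiplesP; exists d => n dn _ /=.
by rewrite subnK.
Qed.

(** The ratio tends to 1, hence is eventually positive, whereas [b n = 0] would make it 0 by the
    convention for division by 0. *)
Lemma near_gt0 : \forall n \near W, 0 < b n.
Proof.
have : \forall n \near W, 0 < b (n - d)%N / b n by apply: cvgr_gt ratio_sub1 _ ltr01.
apply: filterS => n; have := b_ge0 n; rewrite le_eqVlt => /predU1P[<-|//].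
by rewrite invr0 mulr0 ltxx.
Qed.

(** A telescoping product of ratios with step [d]. *)
Lemma ratio_sub m : (d %| m)%N -> b (n - m)%N / b n @[n --> W] --> (1 : R).
Proof.
case/dvdnP => j ->; elim: j => [|j IH].
  apply: cvg_near_cst; near=> n.
  by rewrite mul0n subn0 divff // gt_eqF //; near: n; exact: near_gt0.
have h : (b (n - d - j * d)%N / b (n - d)%N) * (b (n - d)%N / b n) @[n --> W] --> (1 * 1 : R).
  apply: cvgM; last exact: ratio_sub1.
  exact: (cvg_comp _ _ (cvg_subn_multiples (dvdnn d)) IH).
rewrite mulr1 in h; move: h; apply: cvg_trans; apply: near_eq_cvg; near=> n => /=.
rewrite mulrA mulfVK; last first.
  apply: lt0r_neq0; near: n.
  exact: (cvg_subn_multiples (dvdnn d)) near_gt0.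
by rewrite mulSn subnDA.
Unshelve. all: by end_near. Qed.

Lemma conv_split u v N n : (N <= n.+1)%N ->
  conv u v n = \sum_(i < N) u i * v (n - i)%N + \sum_(N <= i < n.+1) u i * v (n - i)%N :> R.
Proof.
move=> Nn; rewrite /conv -(big_mkord xpredT (fun i => u i * v (n - i)%N)).
by rewrite (big_cat_nat (leq0n N) Nn) big_mkord.
Qed.

(** The head of a convolution: [ratio_sub] handles the multiples of [d], and the other terms are
    0. *)
Lemma sum_shift_cvg u N : (forall n, ~~ (d %| n)%N -> u n = 0) ->
  (\sum_(i < N) u i * b (n - i)%N) / b n @[n --> W] --> \sum_(i < N) u i.
Proof.
move=> ud; under eq_fun do rewrite mulr_suml.
apply: (@cvg_sum_ord _ _ _ _ (fun i n => u i * b (n - i)%N / b n)) => i.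
under eq_fun do rewrite -mulrA.
have [di|/ud ->] := boolP (d %| i)%N; last first.
  by under eq_fun do rewrite mul0r; exact: cvg_cst.
have h : u i * (b (n - i)%N / b n) @[n --> W] --> u i * 1.
  by apply: cvgMl_tmp; exact: ratio_sub.
by rewrite mulr1 in h.
Qed.

Lemma conv_near_le (a : R) : 2 * B < a -> \forall n \near W, conv b b n <= a * b n.
Proof.
move=> Ba; near=> n; rewrite -ler_pdivrMr; near: n; last exact: near_gt0.
exact: cvgr_le b_conv _ Ba.
Unshelve. all: by end_near. Qed.

Lemma sum_limit_ge0 : 0 <= B.
Proof.
rewrite -(cvg_lim (@Rhausdorff R) b_sum); apply: limr_ge.
  by apply/cvg_ex; exists B.
by apply: nearW => n; apply: sumr_ge0.
Qed.

(** The head of the convolution tends to a partial sum of [w]. In the tail [w] is at most a small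
    multiple of [b], and [conv b b n] is of order [b n]. *)
Lemma conv_little_o (w : nat -> R) (S : R) : (forall n, ~~ (d %| n)%N -> w n = 0) ->
  \sum_(i < n) w i @[n --> \oo] --> S -> w n / b n @[n --> W] --> (0 : R) ->
  conv w b n / b n @[n --> W] --> S.
Proof.
move=> wd wS w0; apply/cvgrPdist_le => e e0.
have a0 : 0 < 2 * B + 1 by rewrite ltr_wpDl // mulr_ge0 // sum_limit_ge0.
(* Eventually [conv b b n <= (2 * B + 1) * b n], so this bounds the tail by [e / 3 * b n]. *)
pose dl := e / 3 / (2 * B + 1).
have dl0 : 0 < dl by rewrite !divr_gt0.
have e3 : 0 < e / 3 by rewrite divr_gt0.
have /near_multiplesP[N1 N1P] : \forall n \near W, `|w n| <= dl * b n.
  near=> n; have bn : 0 < b n by near: n; exact: near_gt0.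
  rewrite -ler_pdivrMr // -[X in _ / X]gtr0_norm // -normf_div -normrN -[- _]sub0r.
  by near: n; move/cvgrPdist_le : w0; apply.
have [N2 _ N2P] : \forall n \near \oo, `|S - \sum_(i < n) w i| <= e / 3.
  by move/cvgrPdist_le : wS; apply.
pose N := maxn N1 N2.
near=> n.
have bn : 0 < b n by near: n; exact: near_gt0.
have Nn : (N <= n)%N by near: n; apply/near_multiplesP; exists N.
rewrite (conv_split _ _ (leqW Nn)) mulrDl opprD addrA.
apply: le_trans (ler_normB _ _) _.
have -> : e = e / 3 + e / 3 + e / 3 by field.
apply: lerD.
  rewrite -[S](subrK (\sum_(i < N) w i)) -addrA; apply: le_trans (ler_normD _ _) _.
  apply: lerD; first by apply: N2P; rewrite /= leq_maxr.
  by near: n; move/cvgrPdist_le : (sum_shift_cvg (N := N) wd); apply.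
rewrite normrM normfV (gtr0_norm bn) ler_pdivrMr //.
apply: (@le_trans _ _ (dl * conv b b n)).
  rewrite (conv_split _ _ (leqW Nn)) mulrDr ler_wpDl //.
    by rewrite mulr_ge0 ?(ltW dl0) // sumr_ge0 // => i _; rewrite mulr_ge0.
  rewrite mulr_sumr; apply: le_trans (ler_norm_sum _ _ _) _.
  rewrite big_nat [leRHS]big_nat; apply: ler_sum => i /andP[Ni _].
  rewrite normrM (ger0_norm (b_ge0 _)) mulrA; apply: ler_wpM2r => //.
  have [di|/wd ->] := boolP (d %| i)%N; last by rewrite normr0 mulr_ge0 // ltW.
  by apply: N1P => //; apply: leq_trans Ni; apply: leq_maxl.
have -> : e / 3 = dl * (2 * B + 1) by rewrite /dl divfK // gt_eqF.
rewrite -[leRHS]mulrA ler_pM2l //; near: n; apply: conv_near_le.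
by rewrite ltrDl.
Unshelve. all: by end_near. Qed.

(* Reduces to [conv_little_o] by subtracting [a * b] from [u]. *)
Lemma conv_limit (u : nat -> R) (S a : R) : (forall n, ~~ (d %| n)%N -> u n = 0) ->
  \sum_(i < n) u i @[n --> \oo] --> S -> u n / b n @[n --> W] --> a ->
  conv u b n / b n @[n --> W] --> a * B + S.
Proof.
move=> ud uS ua; pose w n := u n - a * b n.
have wd n : ~~ (d %| n)%N -> w n = 0.
  by move=> dn; rewrite /w ud // b_dvd // mulr0 subr0.
have wS : \sum_(i < n) w i @[n --> \oo] --> S - a * B.
  under eq_fun do rewrite /w sumrB -mulr_sumr.
  by apply: cvgB => //; apply: cvgMl_tmp.
have w0 : w n / b n @[n --> W] --> (0 : R).
  have : u n / b n - a @[n --> W] --> a - a by apply: cvgB => //; apply: cvg_cst.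
  rewrite subrr; apply: cvg_trans; apply: near_eq_cvg; near=> n.
  rewrite /w mulrBl mulfK // gt_eqF //; near: n; exact: near_gt0.
have h : conv w b n / b n + a * (conv b b n / b n) @[n --> W] --> S - a * B + a * (2 * B).
  by apply: cvgD; [exact: conv_little_o | exact: cvgMl_tmp].
rewrite (_ : S - a * B + a * (2 * B) = a * B + S) in h; last by ring.
move: h; apply: cvg_trans; apply: near_eq_cvg; near=> n => /=.
rewrite mulrA -mulrDl; congr (_ / _); rewrite /conv mulr_sumr -big_split.
by apply: eq_bigr => i _; rewrite /w /=; ring.
Unshelve. all: by end_near. Qed.

Lemma sum_conv (u v : nat -> R) N :
  \sum_(n < N) conv u v n = \sum_(i < N) u i * \sum_(j < N - i) v j.
Proof.
elim: N => [|N IH]; first by rewrite !big_ord0.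
rewrite big_ord_recr /= IH {IH}.
transitivity (\sum_(i < N.+1) (u i * (\sum_(j < N - i) v j) + u i * v (N - i)%N)).
  by rewrite big_split; congr (_ + _); rewrite big_ord_recr /= subnn big_ord0 mulr0 addr0.
apply: eq_bigr => -[i /=]; rewrite ltnS => iN _.
by rewrite subSn // big_ord_recr mulrDr.
Qed.

Lemma ler_sum_ord (u : nat -> R) m n : (forall i, 0 <= u i) -> (m <= n)%N ->
  \sum_(i < m) u i <= \sum_(i < n) u i.
Proof.
move=> u0 mn; rewrite -!(big_mkord xpredT u) (big_cat_nat (leq0n m) mn) lerDl.
by apply: sumr_ge0 => i _.
Qed.

(** Cauchy product: the triangle [i + j < n] contains the square of side [n./2] and lies in the
    square of side [n]. *)
Lemma sum_conv_cvg (u v : nat -> R) (U V : R) :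
  (forall n, 0 <= u n) -> (forall n, 0 <= v n) ->
  \sum_(i < n) u i @[n --> \oo] --> U -> \sum_(i < n) v i @[n --> \oo] --> V ->
  \sum_(i < n) conv u v i @[n --> \oo] --> U * V.
Proof.
move=> u0 v0 uU vV.
have half : n./2 @[n --> \oo] --> \oo.
  move=> P [N _ NP]; exists N.*2 => // n /= Nn; apply: NP => /=.
  by rewrite -(doubleK N) half_leq.
have h1 : (\sum_(i < n./2) u i) * (\sum_(i < n./2) v i) @[n --> \oo] --> U * V.
  by apply: cvgM; [exact: (cvg_comp _ _ half uU) | exact: (cvg_comp _ _ half vV)].
have h2 : (\sum_(i < n) u i) * (\sum_(i < n) v i) @[n --> \oo] --> U * V.
  exact: cvgM.
apply: squeeze_cvgr h1 h2; apply: nearW => n; rewrite sum_conv; apply/andP; split.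
  rewrite mulr_suml; apply: (@le_trans _ _ (\sum_(i < n./2) u i * \sum_(j < n - i) v j)).
    apply: ler_sum => -[i /= i_n] _; apply: ler_wpM2l => //; apply: ler_sum_ord => //.
    by move: i_n; clear; lia.
  apply: (@ler_sum_ord (fun i => u i * \sum_(j < n - i) v j)) => [i|].
    by rewrite mulr_ge0 // sumr_ge0.
  by rewrite -divn2 leq_div.
rewrite mulr_suml; apply: ler_sum => i _; apply: ler_wpM2l => //.
by apply: ler_sum_ord => //; apply: leq_subr.
Qed.

Lemma sum_cpow_cvg k : \sum_(i < n) cpow b k i @[n --> \oo] --> B ^+ k.
Proof.
elim: k => [|k IH].
  apply: cvg_near_cst; exists 1%N => // -[//|n] _.
  by rewrite big_ord_recl big1 ?addr0.
rewrite exprSr; apply: sum_conv_cvg => // n; exact: cpow_ge0.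
Qed.

Lemma sum_cpow_le k N : \sum_(i < N) cpow b k i <= B ^+ k.
Proof.
rewrite -(cvg_lim (@Rhausdorff R) (@sum_cpow_cvg k)).
apply: limr_ge; first by apply/cvg_ex; exists (B ^+ k); exact: sum_cpow_cvg.
exists N => // n /= Nn; apply: ler_sum_ord => // i; exact: cpow_ge0.
Qed.

Lemma cpow_le k n : cpow b k n <= B ^+ k.
Proof.
apply: le_trans (sum_cpow_le k n.+1); rewrite big_ord_recr lerDr.
by apply: sumr_ge0 => i _; apply: cpow_ge0.
Qed.

(** The induction step is [conv_limit] for [cpow b k], whose total sum is [B ^+ k]. *)
Lemma cpow_limit k : cpow b k n / b n @[n --> W] --> k%:R * B ^+ k.-1.
Proof.
elim: k => [|k IH].
  rewrite mul0r; apply: cvg_near_cst; apply/near_multiplesP; exists 1%N => -[//|n] _ _.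
  by rewrite /= mul0r.
have -> : k.+1%:R * B ^+ k.+1.-1 = k%:R * B ^+ k.-1 * B + B ^+ k.
  case: k {IH} => [|k] /=; first by rewrite mul0r mul0r add0r mul1r.
  by rewrite -natr1 exprSr; ring.
apply: conv_limit IH; last exact: sum_cpow_cvg.
by move=> n; apply: cpow_dvdn.
Qed.

(* Kesten's bound. In the convolution [cpow b k * b] the indices [i < N] contribute
   at most [C * B ^+ k * b n], because [b (n - i) / b n] is bounded there; the
   remaining ones satisfy the induction hypothesis, and [N] is so large that
   they multiply the constant by at most [beta' < beta]. *)
Lemma cpow_exp_bound (beta : R) : B < beta -> exists K N, 0 <= K /\
  forall k n, (N <= n)%N -> cpow b k n <= K * beta ^+ k * b n.
Proof.
move=> Bbeta; have B0 := sum_limit_ge0.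
pose beta' := (B + beta) / 2.
have Bbeta' : B < beta' by rewrite /beta'; lra.
have beta'lt : beta' < beta by rewrite /beta'; lra.
(* Once the first [A] terms are removed from [conv b b n / b n], the limit is below [beta']. *)
have [A _ /(_ A (leqnn _)) AP] : \forall n \near \oo, 2 * B - beta' < \sum_(i < n) b i.
  by apply: (cvgr_gt _ b_sum); lra.
pose tail n := conv b b n / b n - (\sum_(i < A) b i * b (n - i)%N) / b n.
have tail_cvg : tail n @[n --> W] --> 2 * B - \sum_(i < A) b i.
  by apply: cvgB => //; apply: sum_shift_cvg.
have /near_multiplesP[N1 N1P] : \forall n \near W, 0 < b n /\ tail n <= beta'.
  near=> n; split; near: n; first exact: near_gt0.
  by apply: cvgr_le tail_cvg _ _; lra.
pose N := maxn (maxn N1 A) 1.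
(* Applying [sum_shift_cvg] to this indicator bounds [b (n - i) / b n] for all multiples [i < N] of
   [d] at once. *)
pose e i := (d %| i)%N%:R : R.
have ed n : ~~ (d %| n)%N -> e n = 0 by rewrite /e => /negbTE ->.
pose C := \sum_(i < N) e i + 1.
have e0 i : 0 <= e i by apply: ler0n.
have C0 : 0 <= C by rewrite addr_ge0 // sumr_ge0.
have /near_multiplesP[M MP] : \forall n \near W,
    0 < b n /\ (\sum_(i < N) e i * b (n - i)%N) / b n <= C.
  near=> n; split; near: n; first exact: near_gt0.
  by apply: cvgr_le (sum_shift_cvg (N := N) ed) _ _; rewrite /C ltrDl.
(* The first summand gives [C + K * beta' <= K * beta], which closes the induction; the second gives
   [1 <= K * b n] for the finitely many [n < M] with [b n > 0]. *)
pose K := C / (beta - beta') + \sum_(i < M) (b i)^-1.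
have bV0 i : 0 <= (b i)^-1 by rewrite invr_ge0.
have K0 : 0 <= K by rewrite addr_ge0 ?sumr_ge0 // divr_ge0 // subr_ge0 ltW.
have beta0 : 0 <= beta by apply: le_trans B0 (ltW Bbeta).
exists K, N; split=> // k.
elim: k => [|k IH] n Nn.
  have : (0 < n)%N by apply: leq_trans Nn; rewrite /N leq_max orbT.
  by case: n {Nn} => // n _; rewrite /= mulr_ge0 // mulr_ge0.
have [dn|dn] := boolP (d %| n)%N; last first.
  by rewrite (cpow_dvdn _ b_dvd dn) mulr_ge0 // mulr_ge0 // exprn_ge0.
have [|bn tailn] := N1P n _ dn.
  by apply: leq_trans Nn; rewrite /N !leq_max leqnn.
have [nM|Mn] := ltnP n M.
  apply: le_trans (cpow_le _ _) _; apply: (@le_trans _ _ (beta ^+ k.+1)).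
    by rewrite lerXn2r ?nnegrE // ltW.
  rewrite [leRHS]mulrAC ler_peMl ?exprn_ge0 // -ler_pdivrMr // mul1r.
  rewrite ler_wpDl ?divr_ge0 ?subr_ge0 ?(ltW beta'lt) //.
  by rewrite (bigD1 (Ordinal nM)) //= lerDl sumr_ge0.
have [_ headn] := MP n Mn dn.
have ck0 i : 0 <= cpow b k i by apply: cpow_ge0.
have head_le : \sum_(i < N) cpow b k i * b (n - i)%N <= C * beta ^+ k * b n.
  apply: (@le_trans _ _ (\sum_(i < N) cpow b k i * (C * b n))).
    apply: ler_sum => i _; have [di|di] := boolP (d %| i)%N; last first.
      by rewrite (cpow_dvdn _ b_dvd di) !mul0r.
    apply: ler_wpM2l => //; move: headn; rewrite ler_pdivrMr //; apply: le_trans.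
    rewrite (bigD1 i) //= /e di mul1r lerDl sumr_ge0 // => j _; exact: mulr_ge0.
  rewrite -mulr_suml [leRHS]mulrAC mulrC; apply: ler_wpM2l; first by rewrite mulr_ge0.
  by apply: le_trans (sum_cpow_le _ _) _; rewrite lerXn2r ?nnegrE // ltW.
have tail_le : \sum_(N <= i < n.+1) cpow b k i * b (n - i)%N <= K * beta ^+ k * (beta' * b n).
  apply: (@le_trans _ _ (\sum_(N <= i < n.+1) (K * beta ^+ k) * (b i * b (n - i)%N))).
    rewrite big_nat [leRHS]big_nat; apply: ler_sum => i /andP[Ni _].
    by rewrite mulrA; apply: ler_wpM2r => //; apply: IH.
  rewrite -mulr_sumr; apply: ler_wpM2l; first by rewrite mulr_ge0 // exprn_ge0.
  move: tailn; rewrite /tail -mulrBl ler_pdivrMr //; apply: le_trans.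
  rewrite (conv_split _ _ (leqW Nn)) addrAC lerDr subr_ge0.
  apply: (@ler_sum_ord (fun i => b i * b (n - i)%N)) => [i|]; first exact: mulr_ge0.
  by rewrite /N !leq_max leqnn orbT.
rewrite -[cpow b k.+1 n]/(conv (cpow b k) b n) (conv_split _ _ (leqW Nn)).
apply: le_trans (lerD head_le tail_le) _.
have key : C + K * beta' <= K * beta.
  rewrite -lerBrDr -mulrBr /K mulrDl divfK ?gt_eqF ?subr_gt0 //.
  by rewrite lerDl mulr_ge0 ?sumr_ge0 // subr_ge0 ltW.
rewrite (_ : _ + _ = (C + K * beta') * (beta ^+ k * b n)); last by ring.
rewrite (_ : K * _ * _ = K * beta * (beta ^+ k * b n)); last by rewrite exprS; ring.
by apply: ler_wpM2r => //; rewrite mulr_ge0 // exprn_ge0.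
Unshelve. all: by end_near. Qed.

(** * Coefficients of a composite series *)

Variables (f : nat -> R) (beta : R).
Hypothesis f_ge0 : forall k, 0 <= f k.
Hypothesis B_beta : B < beta.
Hypothesis f_beta : cvgn (series (fun k => f k * beta ^+ k)).

Let deriv_term k : R := f k * (k%:R * B ^+ k.-1).

(** Letting [n] tend to infinity in Kesten's bound gives [k * B ^ (k - 1) <= K * beta ^ k], and the
    series of [f] converges at [beta]. *)
Lemma is_cvg_deriv_series : cvgn (series deriv_term).
Proof.
have [K [N [K0 KP]]] := cpow_exp_bound B_beta.
apply: (@series_le_cvg _ deriv_term (fun k => K * (f k * beta ^+ k))).
- by move=> k; rewrite mulr_ge0 // mulr_ge0 // exprn_ge0 // sum_limit_ge0.
- move=> k; rewrite mulr_ge0 // mulr_ge0 // exprn_ge0 //.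
  exact: le_trans sum_limit_ge0 (ltW B_beta).
- move=> k; rewrite mulrCA; apply: ler_wpM2l => //.
  apply: (cvgr_to_le (@cpow_limit k)); near=> n.
  have bn : 0 < b n by near: n; exact: near_gt0.
  rewrite ler_pdivrMr //; apply: KP; near: n.
  by apply/near_multiplesP; exists N.
- exact: is_cvg_seriesZ.
Unshelve. all: by end_near. Qed.

(** Dominated convergence by hand: a finite sum converges termwise, and the rest is dominated by a
    tail of the series of [f] at [beta]. *)
Lemma comp_coef_limit :
  (\sum_(k < n.+1) f k * cpow b k n) / b n @[n --> W] --> limn (series deriv_term).
Proof.
have [K [N [K0 KP]]] := cpow_exp_bound B_beta.
have beta0 : 0 <= beta by apply: le_trans sum_limit_ge0 (ltW B_beta).
set L := limn (series deriv_term).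
pose T := limn (series (fun k => f k * beta ^+ k)).
have TE n : series (fun k => f k * beta ^+ k) n = \sum_(k < n) f k * beta ^+ k.
  by rewrite seriesEord.
have sT : \sum_(k < n) f k * beta ^+ k @[n --> \oo] --> T.
  by have : series (fun k => f k * beta ^+ k) @ \oo --> T by []; rewrite seriesEord.
have sL : \sum_(k < n) deriv_term k @[n --> \oo] --> L.
  by have := is_cvg_deriv_series; rewrite /L seriesEord.
have t0 k : 0 <= f k * beta ^+ k by rewrite mulr_ge0 // exprn_ge0.
apply/cvgrPdist_le => e e0.
have e3 : 0 < e / 3 by rewrite divr_gt0.
have K1 : 0 < K + 1 by rewrite ltr_wpDl.
(* [K] is only known to be non-negative, hence the division by [K + 1]. *)
have eK : 0 < e / 3 / (K + 1) by rewrite divr_gt0.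
have [M1 _ M1P] : \forall n \near \oo, `|L - \sum_(k < n) deriv_term k| <= e / 3.
  by move/cvgrPdist_le : sL; apply.
have [M2 _ M2P] : \forall n \near \oo,
    `|T - \sum_(k < n) f k * beta ^+ k| <= e / 3 / (K + 1).
  by move/cvgrPdist_le : sT; apply.
pose M := maxn M1 M2.
have finite_part : \sum_(k < M) f k * (cpow b k n / b n) @[n --> W] --> \sum_(k < M) deriv_term k.
  apply: (@cvg_sum_ord _ _ _ _ (fun k n => f k * (cpow b k n / b n))) => k.
  by apply: cvgMl_tmp; apply: cpow_limit.
near=> n.
have bn : 0 < b n by near: n; exact: near_gt0.
have Mn : (M <= n.+1)%N by near: n; apply/near_multiplesP; exists M => n Mn _; apply: leqW.
have Nn : (N <= n)%N by near: n; apply/near_multiplesP; exists N.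
rewrite -(big_mkord xpredT (fun k => f k * cpow b k n)) (big_cat_nat (leq0n M) Mn) /= big_mkord.
rewrite mulrDl opprD addrA; apply: le_trans (ler_normB _ _) _.
have -> : e = e / 3 + e / 3 + e / 3 by field.
apply: lerD.
  rewrite -[L](subrK (\sum_(k < M) deriv_term k)) -addrA; apply: le_trans (ler_normD _ _) _.
  apply: lerD; first by apply: M1P; rewrite /= leq_maxl.
  rewrite mulr_suml; under [X in _ - X]eq_bigr do rewrite -mulrA.
  by near: n; move/cvgrPdist_le : finite_part; apply.
rewrite ger0_norm; last first.
  by rewrite divr_ge0 // sumr_ge0 // => k _; rewrite mulr_ge0 // cpow_ge0.
rewrite ler_pdivrMr //.
apply: (@le_trans _ _ (\sum_(M <= k < n.+1) (K * b n) * (f k * beta ^+ k))).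
  apply: ler_sum => k _; rewrite mulrCA; apply: ler_wpM2l => //.
  by rewrite mulrAC; apply: KP.
rewrite -mulr_sumr mulrAC; apply: ler_wpM2r; first exact: ltW.
apply: (@le_trans _ _ (K * (e / 3 / (K + 1)))).
  apply: ler_wpM2l => //.
  have -> : \sum_(M <= k < n.+1) f k * beta ^+ k =
      \sum_(k < n.+1) f k * beta ^+ k - \sum_(k < M) f k * beta ^+ k.
    rewrite -!(big_mkord xpredT (fun k => f k * beta ^+ k)) (big_cat_nat (leq0n M) Mn).
    by rewrite /= addrAC subrr add0r.
  apply: (@le_trans _ _ (T - \sum_(k < M) f k * beta ^+ k)).
    rewrite lerD2r /T -TE; apply: nondecreasing_cvgn_le => //.
    by apply: nondecreasing_series => k _ _.
  by apply: le_trans (ler_norm _) _; apply: M2P; rewrite /= leq_maxr.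
rewrite mulrA ler_pdivrMr // mulrC; apply: ler_wpM2l; first exact: ltW.
by rewrite lerDl.
Unshelve. all: by end_near. Qed.

End Subexponential.

(** * Total variation distance *)

Section Scheffe.
Variables (R : realType) (S : countType).
Implicit Types (p q : S -> R) (s t : seq S) (E : set S).

(** Together with [esum_seq_ge], reduces extended sums to finite sums over duplicate-free
    sequences. *)
Lemma esum_seq_le p E c : (forall t, uniq t -> (forall x, x \in t -> E x) ->
  \sum_(x <- t) p x <= c) -> (\esum_(x in E) (p x)%:E <= c%:E)%E.
Proof.
move=> H; apply: ge_ereal_sup => _ [A [finA AE] <-].
rewrite fsbig_finite // sumEFin lee_fin; apply: H => [|x]; first exact: finmap.fset_uniq.
by rewrite in_fset_set // inE => /AE.
Qed.

Lemma esum_seq_ge p E t : uniq t -> (forall x, x \in t -> E x) ->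
  ((\sum_(x <- t) p x)%:E <= \esum_(x in E) (p x)%:E)%E.
Proof.
move=> ut tE; apply: esum_ge; exists [set` t]; last by rewrite -fsbig_seq // sumEFin.
by split; [exact: finite_seq | move=> x /= /tE].
Qed.

Lemma ler_sum_subseq p s t : (forall x, 0 <= p x) -> uniq s -> uniq t ->
  {subset t <= s} -> \sum_(x <- t) p x <= \sum_(x <- s) p x.
Proof.
move=> p0 us ut ts; have st : perm_eq [seq x <- s | x \in t] t.
  apply: uniq_perm => //; first exact: filter_uniq.
  by move=> x; rewrite mem_filter; apply/andP/idP => [[]//|xt]; split=> //; apply: ts.
rewrite [leRHS](bigID (mem t)) /= -[X in X + _]big_filter (perm_big t st) lerDl.
by apply: sumr_ge0 => x _.
Qed.

(** On [s] the masses differ by at most [e]; outside [s] the law [p] has at most [2 * e] left, its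
    total being at most 1. *)
Lemma esum_close p q s e E : (forall x, 0 <= p x) -> (forall x, 0 <= q x) ->
  (forall t, uniq t -> \sum_(x <- t) p x <= 1) -> uniq s ->
  1 - 2 * e <= \sum_(x <- s) p x -> \sum_(x <- s) `|p x - q x| <= e ->
  \esum_(x in E) (q x)%:E \is a fin_num ->
  (\esum_(x in E) (p x)%:E <= \esum_(x in E) (q x)%:E + (3 * e)%:E)%E.
Proof.
move=> p0 q0 p1 us sp spq qfin; rewrite -(fineK qfin) -EFinD; apply: esum_seq_le => t ut tE.
rewrite (bigID (mem s)) /= -[X in X + _]big_filter -[X in _ + X]big_filter.
set t1 := [seq x <- t | x \in s]; set t2 := [seq x <- t | x \notin s].
have ut1 : uniq t1 by apply: filter_uniq.
have h1 : \sum_(x <- t1) p x <= \sum_(x <- t1) q x + e.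
  apply: (@le_trans _ _ (\sum_(x <- t1) (q x + `|p x - q x|))).
    by apply: ler_sum => x _; rewrite -lerBlDl ler_norm.
  rewrite big_split lerD2l; apply: le_trans spq.
  apply: (@ler_sum_subseq (fun x => `|p x - q x|)) => // x.
  by rewrite mem_filter => /andP[].
have h2 : \sum_(x <- t1) q x <= fine (\esum_(x in E) (q x)%:E).
  rewrite -lee_fin fineK //; apply: esum_seq_ge => // x.
  by rewrite mem_filter => /andP[_ /tE].
have h3 : \sum_(x <- s) p x + \sum_(x <- t2) p x <= 1.
  rewrite -big_cat; apply: p1; rewrite cat_uniq us filter_uniq // andbT.
  by apply/hasPn => x; rewrite mem_filter => /andP[].
lra.
Qed.

(** Quantitative form of Scheffe's argument. Concentration is required of [q] alone: closeness on
    [s] passes it on to [p] with [2 * e] in place of [e], and [esum_close] is used in both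
    directions. *)
Lemma dTV_le p q s e : (forall x, 0 <= p x) -> (forall x, 0 <= q x) ->
  (forall t, uniq t -> \sum_(x <- t) p x <= 1) ->
  (forall t, uniq t -> \sum_(x <- t) q x <= 1) -> uniq s -> 0 <= e ->
  1 - e <= \sum_(x <- s) q x -> \sum_(x <- s) `|p x - q x| <= e ->
  (dTV p q <= (3 * e)%:E)%E.
Proof.
move=> p0 q0 p1 q1 us e0 sq spq; apply: ge_ereal_sup => _ [E _ <-].
have fin (u : S -> R) : (forall x, 0 <= u x) -> (forall t, uniq t -> \sum_(x <- t) u x <= 1) ->
    \esum_(x in E) (u x)%:E \is a fin_num.
  move=> u0 u1; have E0 : (0 <= \esum_(x in E) (u x)%:E)%E.
    by apply: esum_ge0 => x _; rewrite lee_fin.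
  rewrite ge0_fin_numE //.
  by apply: le_lt_trans (ltry 1); apply: esum_seq_le => t ut _; apply: u1.
have sp : 1 - 2 * e <= \sum_(x <- s) p x.
  have : \sum_(x <- s) q x - \sum_(x <- s) p x <= \sum_(x <- s) `|p x - q x|.
    by rewrite -sumrB; apply: ler_sum => x _; rewrite distrC ler_norm.
  lra.
have spq' : \sum_(x <- s) `|q x - p x| <= e by under eq_bigr do rewrite distrC.
have pfin := fin p p0 p1; have qfin := fin q q0 q1.
have h1 := esum_close p0 q0 p1 us sp spq qfin.
have h2 : (\esum_(x in E) (q x)%:E <= \esum_(x in E) (p x)%:E + (3 * e)%:E)%E.
  by apply: (esum_close q0 p0 q1 us _ spq' pfin); lra.
have px := fineK pfin; have qy := fineK qfin.
set x := fine _ in px; set y := fine _ in qy.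
rewrite -px -qy -!EFinD !lee_fin in h1 h2.
by rewrite -px -qy -EFinB abse_EFin lee_fin ler_norml; lra.
Qed.

Lemma dTV_ge0 p q : (0 <= dTV p q)%E.
Proof.
by apply: le_trans (ereal_sup_ubound _); last (by exists setT); exact: abse_ge0.
Qed.

End Scheffe.

(** * Convergence to the Boltzmann law *)

Section BoltzmannLimit.
Variables (R : realType) (F G : species R) (d : nat) (rho : R).
Hypothesis G_empty : #|G void| = 0%N.
Hypothesis F_nonconstant : exists k : nat, (1 <= k)%N /\ 0 < egf F k.
Hypothesis d_gt0 : (0 < d)%N.
Hypothesis G_class : in_class_S d rho (egf G).
Hypothesis F_radius : ((psum (egf G) rho)%:E < conv_radius (egf F))%E.

Local Notation W := (within [set n | (d %| n)%N] \oo).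
Let W_proper : ProperFilter W := multiples_proper d_gt0.
#[local] Existing Instance W_proper.

Local Notation FG := (species_comp F G).
Local Notation FG' := (species_comp (species_deriv F) G).
Local Notation B := (psum (egf G) rho).
Local Notation L := (psum (egf (species_deriv F)) B).
Let b n : R := egf G n * rho ^+ n.

Lemma egf_G0 : egf G 0 = 0.
Proof.
rewrite /egf (@sum_sp_wt_card _ G 'I_0 void) ?card_ord ?card_void //.
by rewrite big_pred0 ?mul0r // => x; have := card0_eq G_empty x; rewrite inE.
Qed.

Let rho0 : 0 < rho. Proof. by case: G_class => -[]. Qed.
Let g_dvd n : ~~ (d %| n)%N -> egf G n = 0. Proof. by case: G_class => _ [h _ _ _]; apply: h. Qed.
Let rho_neq0 n : rho ^+ n != 0. Proof. by rewrite expf_neq0 // gt_eqF. Qed.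

Lemma scaled_egf_ge0 n : 0 <= b n.
Proof. by rewrite mulr_ge0 ?egf_ge0 // exprn_ge0 // ltW. Qed.

Lemma scaled_egf_dvd n : ~~ (d %| n)%N -> b n = 0.
Proof. by move=> /g_dvd; rewrite /b => ->; rewrite mul0r. Qed.

Lemma scaled_egf_ratio : b n / b (n + d)%N @[n --> W] --> (1 : R).
Proof.
have h : egf G n / egf G (n + d)%N / rho ^+ d @[n --> W] --> rho ^+ d / rho ^+ d.
  by case: G_class => _ [_ h _ _]; apply: cvgMr_tmp.
rewrite divff // in h; apply: cvg_trans h; apply: near_eq_cvg; apply: nearW => n.
rewrite /b exprD; have := rho_neq0 n; have := rho_neq0 d.
move: (egf G n) (egf G (n + d)%N) (rho ^+ n) (rho ^+ d) => g g' x y y0 x0.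
(* The coefficient [g'] may be 0; generalising its inverse spares [field] that side condition. *)
by rewrite !invfM; move: g'^-1 => z; field; rewrite x0 y0.
Qed.

Lemma scaled_egf_sum : \sum_(i < n) b i @[n --> \oo] --> B.
Proof.
have : pseries (egf G) rho @ \oo --> B by case: G_class => _ [].
by rewrite /pseries seriesEord.
Qed.

Lemma scaled_egf_conv : conv b b n / b n @[n --> W] --> 2 * B.
Proof.
case: G_class => _ [_ _ _ h]; apply: cvg_trans h; apply: near_eq_cvg; apply: nearW => n.
have -> : conv b b n = (\sum_(i < n.+1) egf G i * egf G (n - i)%N) * rho ^+ n.
  rewrite mulr_suml; apply: eq_bigr => -[i /=]; rewrite ltnS => i_n _.
  by rewrite /b mulrACA -exprD subnKC.
rewrite /b; have := rho_neq0 n; set s := \sum_(i < n.+1) _.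
move: s (rho ^+ n) (egf G n) => s x g x0.
by rewrite invfM; move: g^-1 => z; field.
Qed.

Lemma radius_witness : exists beta, B < beta /\ cvgn (pseries (egf F) beta).
Proof.
have [_ [x Fx <-] Bx] := ereal_sup_gt F_radius; rewrite lte_fin in Bx.
(* Convergence at [x], possibly negative, says nothing about the modulus of [x] itself; the midpoint
   lies strictly inside the disc. *)
exists ((B + `|x|) / 2); split; first by lra.
apply: is_cvg_pseries_inside Fx _; have := @sum_limit_ge0 _ b B scaled_egf_ge0 scaled_egf_sum => B0.
by rewrite ger0_norm; lra.
Qed.

Let deriv_series := series (fun k => egf F k * (k%:R * B ^+ k.-1)).

Lemma is_cvg_egf_deriv : cvgn deriv_series.
Proof.
have [beta [Bbeta Fbeta]] := radius_witness.
exact: (is_cvg_deriv_series d_gt0 scaled_egf_ge0 scaled_egf_dvd scaled_egf_ratio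
  scaled_egf_sum scaled_egf_conv (@egf_ge0 _ F) Bbeta Fbeta).
Qed.

(** Differentiation shifts the index by one, and the term of index 0 of [deriv_series] is 0. *)
Lemma pseries_deriv_cvg :
  pseries (egf (species_deriv F)) B @ \oo --> limn deriv_series.
Proof.
have h : deriv_series n.+1 @[n --> \oo] --> limn deriv_series.
  by rewrite cvg_shiftS; exact: is_cvg_egf_deriv.
suff -> : pseries (egf (species_deriv F)) B = (fun n => deriv_series n.+1) by [].
apply/funext => n; rewrite /deriv_series /pseries !seriesEord /= big_ord_recl.
rewrite mul0r mulr0 add0r; apply: eq_bigr => k _.
rewrite egf_deriv lift0 -[k.+1.-1]/(k : nat).
by rewrite [RHS]mulrCA [RHS]mulrA.
Qed.

Lemma psum_deriv_lim : L = limn deriv_series.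
Proof. exact: (cvg_lim (@Rhausdorff R) pseries_deriv_cvg). Qed.

(** [L] has to be inverted. Some [b n] is positive and at most [B], so [B] is positive and the index
    from [F_nonconstant] contributes a positive term. *)
Lemma psum_deriv_gt0 : 0 < L.
Proof.
have [k [k1 fk]] := F_nonconstant.
have [n bn] := filter_ex (near_gt0 scaled_egf_ge0 scaled_egf_ratio).
have B0 : 0 < B.
  have h := cpow_le scaled_egf_ge0 scaled_egf_sum 1 n; rewrite expr1 in h.
  apply: lt_le_trans bn (le_trans _ h).
  rewrite /cpow /conv big_ord_recl mul1r subn0 lerDl sumr_ge0 // => i _.
  by rewrite mulr_ge0 ?ler0n ?scaled_egf_ge0.
have t0 j : 0 <= egf F j * (j%:R * B ^+ j.-1).
  by rewrite mulr_ge0 ?egf_ge0 // mulr_ge0 // exprn_ge0 // ltW.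
rewrite psum_deriv_lim; apply: (@lt_le_trans _ _ (deriv_series k.+1)).
  rewrite /deriv_series seriesEord /= big_ord_recr /= ltr_wpDl ?sumr_ge0 //.
  by rewrite mulr_gt0 // mulr_gt0 ?ltr0n // exprn_gt0.
apply: nondecreasing_cvgn_le; last exact: is_cvg_egf_deriv.
by apply: nondecreasing_series => j _ _.
Qed.

Lemma egf_comp_ratio : egf FG n / egf G n @[n --> W] --> L.
Proof.
have [beta [Bbeta Fbeta]] := radius_witness.
rewrite psum_deriv_lim.
have := comp_coef_limit d_gt0 scaled_egf_ge0 scaled_egf_dvd scaled_egf_ratio
  scaled_egf_sum scaled_egf_conv (@egf_ge0 _ F) Bbeta Fbeta.
apply: cvg_trans; apply: near_eq_cvg; apply: nearW => n.
rewrite (@egf_comp _ F G n) ?egf_G0 //.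
under eq_bigr do rewrite /b cpow_scale mulrA.
rewrite -mulr_suml /b; have := rho_neq0 n.
move: (bigop.body _ _ _) (rho ^+ n) (egf G n) => s x g x0.
by rewrite invfM; move: g^-1 => z; field.
Qed.

(** The coefficient of [F' o G] vanishes and is a sum of non-negative weights. This settles the
    sizes for which [ratio_sub] gives no limit. *)
Lemma comp_deriv_wt0 m (x : FG' 'I_m) : ~~ (d %| m)%N -> sp_wt x = 0.
Proof.
move=> dm; have : egf FG' m = 0.
  rewrite (@egf_comp _ _ G m) ?egf_G0 // big1 // => k _.
  by rewrite (cpow_dvdn _ g_dvd dm) mulr0.
move/eqP; rewrite mulf_eq0 invr_eq0 pnatr_eq0 -[_ == 0%N]negbK -lt0n fact_gt0 orbF.
rewrite psumr_eq0 => [/allP h|y _]; last exact: sp_wt_ge0.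
by apply/eqP; apply: h; rewrite mem_index_enum.
Qed.

Lemma remainder_law_limit r : remainder_law F G n r @[n --> W] --> boltzmann F G rho r.
Proof.
case: r => m x.
have [dm|dm] := boolP (d %| m)%N; last first.
  rewrite /boltzmann (comp_deriv_wt0 x dm) !mul0r; apply: cvg_near_cst.
  apply/near_multiplesP; exists (2 * m).+1 => n mn _.
  by rewrite remainder_lawE // (comp_deriv_wt0 x dm) !mul0r.
have L0 := psum_deriv_gt0.
(* The quotient of [egf G (n - m)] by [egf FG n], split into factors with known limits. *)
have h : sp_wt x / m`!%:R * ((b (n - m)%N / b n) * rho ^+ m * (egf FG n / egf G n)^-1)
    @[n --> W] --> sp_wt x / m`!%:R * (1 * rho ^+ m * L^-1).
  apply: cvgMl_tmp; apply: cvgM; first apply: cvgMr_tmp.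
    exact: (ratio_sub scaled_egf_ge0 scaled_egf_ratio).
  by apply: cvgV; [rewrite gt_eqF|exact: egf_comp_ratio].
have -> : boltzmann F G rho (Tagged (fun k => FG' 'I_k) x) =
    sp_wt x / m`!%:R * (1 * rho ^+ m * L^-1).
  by rewrite /boltzmann /= mul1r; ring.
move: h; apply: cvg_trans; apply: near_eq_cvg; near=> n.
have mn : (2 * m < n)%N by near: n; apply/near_multiplesP; exists (2 * m).+1.
have bn : 0 < b n by near: n; exact: (near_gt0 scaled_egf_ge0 scaled_egf_ratio).
rewrite remainder_lawE //=; congr (_ * _).
have g0 : egf G n != 0 by apply: contraTneq bn => gn; rewrite /b gn mul0r ltxx.
have e : rho ^+ n = rho ^+ m * rho ^+ (n - m) by rewrite -exprD subnKC //; lia.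
rewrite /b e invf_div; have := rho_neq0 m; have := rho_neq0 (n - m).
move: (egf G n) g0 (egf G (n - m)%N) (rho ^+ m) (rho ^+ (n - m)) => g g0 g' y z z0 y0.
by move: (egf FG n)^-1 => a; field; rewrite g0 y0 z0.
Unshelve. all: by end_near. Qed.

Lemma sum_boltzmann_size M : exists s : seq (structures FG'), uniq s /\
  \sum_(r <- s) boltzmann F G rho r = (\sum_(m < M) egf FG' m * rho ^+ m) / L.
Proof.
pose s := [seq Tagged (fun k => FG' 'I_k) x | m <- iota 0 M, x <- enum (FG' 'I_m)].
exists s; split.
  apply: allpairs_uniq_dep; [exact: iota_uniq|by move=> m _; exact: enum_uniq|].
  by move=> [m x] [m' x'] _ _.
rewrite big_allpairs_dep -[M]subn0 -/(index_iota 0 M) big_mkord mulr_suml subn0.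
apply: eq_bigr => m _; rewrite big_enum /egf.
by rewrite !mulr_suml; apply: eq_bigr => x _; rewrite /boltzmann /=; ring.
Qed.

(** Finite truncations replace an exchange of infinite sums: the series of [F'] at [B] is cut at
    [K], losing [e * L / 2], then the powers of [b] are cut at a common size, losing as much
    again. *)
Lemma boltzmann_mass_near e : 0 < e ->
  exists s, uniq s /\ 1 - e <= \sum_(r <- s) boltzmann F G rho r.
Proof.
move=> e0; have L0 := psum_deriv_gt0; have eL : 0 < e * L / 2 by rewrite divr_gt0 ?mulr_gt0.
have B0 := sum_limit_ge0 scaled_egf_ge0 scaled_egf_sum.
have sL : \sum_(k < n) egf (species_deriv F) k * B ^+ k @[n --> \oo] --> L.
  have : pseries (egf (species_deriv F)) B @ \oo --> L.
    by rewrite psum_deriv_lim; exact: pseries_deriv_cvg.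
  by rewrite /pseries seriesEord.
have [K _ /(_ K (leqnn _)) KP] : \forall n \near \oo,
    L - e * L / 2 < \sum_(k < n) egf (species_deriv F) k * B ^+ k.
  by apply: (cvgr_gt _ sL); lra.
have sK : \sum_(k < K) egf (species_deriv F) k * (\sum_(m < n) cpow b k m) @[n --> \oo]
    --> \sum_(k < K) egf (species_deriv F) k * B ^+ k.
  apply: (@cvg_sum_ord _ _ _ _ (fun k n => egf (species_deriv F) k * (\sum_(m < n) cpow b k m))
    (fun k => egf (species_deriv F) k * B ^+ k)) => k.
  by apply: cvgMl_tmp; apply: sum_cpow_cvg scaled_egf_ge0 scaled_egf_sum k.
have [N _ NP] : \forall n \near \oo,
    L - e * L < \sum_(k < K) egf (species_deriv F) k * (\sum_(m < n) cpow b k m).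
  by apply: (cvgr_gt _ sK); lra.
(* With this choice [egf_comp] at [maxn N K] covers every size below [M] with the same range of [k],
   and all terms below [K] are included. *)
pose M := (maxn N K).+1.
have [s [us sE]] := sum_boltzmann_size M; exists s; split=> //.
rewrite sE ler_pdivlMr // mulrBl mul1r; apply: ltW.
have := NP M; rewrite /= => /(_ _)/lt_le_trans; apply; first by apply/leqW/leq_maxl.
apply: (@le_trans _ _ (\sum_(k < M) egf (species_deriv F) k * (\sum_(m < M) cpow b k m))).
  apply: (@ler_sum_ord _ (fun k => egf (species_deriv F) k * (\sum_(m < M) cpow b k m))).
    by move=> k; rewrite mulr_ge0 ?egf_ge0 // sumr_ge0 // => m _; apply: cpow_ge0 scaled_egf_ge0.
  by apply/leqW/leq_maxr.
under [leLHS]eq_bigr do rewrite mulr_sumr.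
rewrite exchange_big; apply: ler_sum => -[m mM] _ /=.
rewrite (@egf_comp _ _ G (maxn N K)) ?egf_G0 // mulr_suml.
by apply: ler_sum => k _; rewrite /b cpow_scale mulrA.
Qed.

Lemma boltzmann_ge0 r : 0 <= boltzmann F G rho r.
Proof.
apply: mulr_ge0; last by rewrite invr_ge0; exact: ltW psum_deriv_gt0.
apply: mulr_ge0; first exact: sp_wt_ge0.
by rewrite divr_ge0 ?ler0n // exprn_ge0 // ltW.
Qed.

(** A Fatou argument: finite sums of the laws of the remainders are at most 1, and this survives the
    pointwise limit. *)
Lemma sum_boltzmann_le1 (t : seq (structures FG')) : uniq t ->
  \sum_(r <- t) boltzmann F G rho r <= 1.
Proof.
move=> ut.
have h : \sum_(r <- t) remainder_law F G n r @[n --> W] --> \sum_(r <- t) boltzmann F G rho r.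
  elim: t {ut} => [|r t IH].
    by under eq_fun do rewrite big_nil; rewrite big_nil; apply: cvg_cst.
  under eq_fun do rewrite big_cons; rewrite big_cons.
  by apply: cvgD => //; apply: remainder_law_limit.
by apply: (cvgr_to_le h); apply: nearW => n; apply: sum_remainder_law_le1.
Qed.

Lemma dTV_remainder_boltzmann :
  dTV (remainder_law F G n) (boltzmann F G rho) @[n --> W] --> 0%E.
Proof.
have close e : 0 < e -> \forall n \near W,
    (dTV (remainder_law F G n) (boltzmann F G rho) <= e%:E)%E.
  move=> e0; have e3 : 0 < e / 3 by rewrite divr_gt0.
  have [s [us sq]] := boltzmann_mass_near e3.
  have h : \sum_(r <- s) `|remainder_law F G n r - boltzmann F G rho r| @[n --> W] --> (0 : R).
    elim: s {us sq} => [|r s IH].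
      by under eq_fun do rewrite big_nil; apply: cvg_cst.
    have hr : `|remainder_law F G n r - boltzmann F G rho r| @[n --> W] -->
        `|boltzmann F G rho r - boltzmann F G rho r|.
      by apply: cvg_norm; apply: cvgB; [exact: remainder_law_limit|exact: cvg_cst].
    rewrite subrr normr0 in hr.
    have hs := cvgD hr IH; rewrite addr0 in hs.
    by under eq_fun do rewrite big_cons; exact: hs.
  (* [dTV_le] loses a factor 3. *)
  near=> n; rewrite (_ : e = 3 * (e / 3)); last by field.
  apply: (@dTV_le _ _ _ _ s) => //.
  - exact: remainder_law_ge0.
  - exact: boltzmann_ge0.
  - exact: sum_remainder_law_le1.
  - exact: sum_boltzmann_le1.
  - exact: ltW.
  - by near: n; apply: cvgr_le h _ _.
apply/fine_cvgP; split.
  near=> n; rewrite ge0_fin_numE ?dTV_ge0 //; apply: le_lt_trans (ltry 1).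
  by near: n; apply: close.
apply/cvgrPdist_le => e e0; near=> n; rewrite sub0r normrN ger0_norm ?fine_ge0 ?dTV_ge0 //.
have h : (dTV (remainder_law F G n) (boltzmann F G rho) <= e%:E)%E by near: n; apply: close.
rewrite -lee_fin fineK // ge0_fin_numE ?dTV_ge0 //.
exact: le_lt_trans h (ltry e).
Unshelve. all: by end_near. Qed.

End BoltzmannLimit.

Theorem theorem3p1 (R : realType) (F G : species R) (d : nat) (rho : R)
  (G_empty : #|G void| = 0%N)
  (F_nonconstant : exists k : nat, (1 <= k)%N /\ 0 < egf F k)
  (FG_not_poly : ~ is_polynomial (egf (species_comp F G)))
  (d_ge1 : (1 <= d)%N)
  (G_class : in_class_S d rho (egf G))
  (F_radius : ((psum (egf G) rho)%:E < conv_radius (egf F))%E) :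
  dTV (remainder_law F G n) (boltzmann F G rho)
    @[n --> within [set n | (d %| n)%N] \oo] --> 0%E.
Proof. exact: (dTV_remainder_boltzmann G_empty F_nonconstant d_ge1 G_class F_radius). Qed.
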